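(* Let $T>0$, $A\in\mathbb{R}^{d\times d}$ and $\Sigma\in\mathbb{R}^{d\times m}$, let $(B_t)_{t\in[0,T)}$ be an $m$-dimensional standard Wiener process, and let $(X_t)_{t\in[0,T)}$ be the unique strong solution of $$\mathrm{d}X_t=-\frac{1}{T-t}AX_t\,\mathrm{d}t+\Sigma\,\mathrm{d}B_t,\quad t\in[0,T),\qquad X_0=0\in\mathbb{R}^d.$$ Let $a_1<\cdots<a_p$ denote the distinct real parts of the eigenvalues of $A$ and let $(X_t^{[j]})_{t\in[0,T)}$, $j=1,\ldots,p$, be the corresponding spectral components of $(X_t)_{t\in[0,T)}$. If $\operatorname{ReSpec}(A)\subseteq(0,\infty)$ and $\Sigma$ has full rank $d$ (and consequently $m\ge d$), then for all $\varepsilon>0$ and all $j\in\{1,\ldots,p\}$, $$P\Big(\lim_{t\uparrow T}(T-t)^{-\min(a_j,1/2)+\varepsilon}\,\|X_t^{[j]}\|=0\Big)=1,$$ $$P\Big(\limsup_{t\uparrow T}(T-t)^{-\min(a_j,1/2)-\varepsilon}\,\|X_t^{[j]}\|=\infty\Big)=1.$$ Further, if $\operatorname{ReSpec}(A)\subseteq(0,1/2)$, then the second assertion can be strengthened to $$P\Big(\lim_{t\uparrow T}(T-t)^{-a_j-\varepsilon}\,\|X_t^{[j]}\|=\infty\Big)=1.$$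
   Context: For $r>0$ and a real square matrix $Q$, $r^Q:=\mathrm{e}^{Q\log r}=\sum_{k=0}^\infty\frac{(\log r)^k}{k!}Q^k$. $\operatorname{ReSpec}(A):=\{\operatorname{Re}\lambda:\lambda\in\operatorname{Spec}(A)\}$, where $\operatorname{Spec}(A)$ is the set of (complex) eigenvalues of $A$. The Wiener process is defined on a filtered probability space $(\Omega,\mathcal{F},(\mathcal{F}_t)_{t\in[0,T)},P)$, where $(\mathcal{F}_t)$ is the completion of its canonical filtration. The solution has the continuous representation $X_t=\int_0^t\big(\frac{T-t}{T-s}\big)^A\Sigma\,\mathrm{d}B_s$, $t\in[0,T)$. Spectral components: factor the minimal polynomial $f$ of $A$ as $f=f_1\cdots f_p$ with real polynomials $f_j$ such that every root of $f_j$ has real part $a_j$, where $a_1<\cdots<a_p$ are the distinct real parts of the eigenvalues of $A$. Then $\mathbb{R}^d=V_1\oplus\cdots\oplus V_p$ with $A$-invariant subspaces $V_j:=\operatorname{Ker}(f_j(A))$ of dimension $d_j$. Fix a basis $\{b_i^{(j)}:i=1,\ldots,d_j\}$ of each $V_j$. For $x=x_1+\cdots+x_p$ with $x_j\in V_j$, let $\pi_j(x)\in\mathbb{R}^{d_j}$ be the coordinate vector of $x_j$ with respect to $\{b_i^{(j)}:i=1,\ldots,d_j\}$; $\pi_j:\mathbb{R}^d\to\mathbb{R}^{d_j}$ is linear. The $j$-th spectral component is $X_t^{[j]}:=\pi_j(X_t)$, and $\|\cdot\|$ is the Euclidean norm on $\mathbb{R}^{d_j}$. *)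

(* Defs.v *)
From HB Require Import structures.
From mathcomp Require Import all_boot all_order all_algebra.
From mathcomp Require Import all_classical all_reals all_analysis.
From mathcomp Require Import complex.

Set Implicit Arguments.
Unset Strict Implicit.
Unset Printing Implicit Defensive.

Import Order.TTheory GRing.Theory Num.Theory.
Import numFieldNormedType.Exports.

Local Open Scope classical_set_scope.
Local Open Scope ring_scope.

(* The norm that the library puts on matrices is the maximum norm. *)
Definition euclid_norm (R : realType) (n : nat) (v : 'cV[R]_n) : R :=
  Num.sqrt (\sum_(i < n) v i 0 ^+ 2).

Section Wiener.
Context (R : realType) (dsp : measure_display) (Omega : measurableType dsp).
Variable P : probability Omega R.

(* For a finite family the product rule over all subfamilies follows from the
   one over the whole family, since some of the [E i] may be [setT]. *)
Definition mutually_independent (I : finType) (Y : I -> Omega -> R) : Prop :=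
  forall E : I -> set R, (forall i, measurable (E i)) ->
    P (\bigcap_(i in [set: I]) (Y i @^-1` E i)) =
    (\prod_(i : I) P (Y i @^-1` E i))%E.

(* Processes are indexed by the whole of [R]; only their values at times in
   [0, T) are ever constrained or used. *)
Definition standard_wiener (T : R) (m : nat) (B : R -> Omega -> 'cV[R]_m) :
    Prop :=
  [/\ forall t, 0 <= t < T ->
        forall i, measurable_fun setT (fun w => B t w i 0),
      {ae P, forall w, B 0 w = 0},
      {ae P, forall w, {within `[0, T[, continuous (fun t => B t w)}},
      forall s t, 0 <= s -> s < t -> t < T ->
        forall (i : 'I_m) (E : set R), measurable E ->
        P ((fun w => B t w i 0 - B s w i 0) @^-1` E) =
        normal_prob 0 (Num.sqrt (t - s)) E
    & forall (n : nat) (t : nat -> R),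
        (forall k, (k <= n)%N -> 0 <= t k < T) ->
        (forall k, (k < n)%N -> t k < t k.+1) ->
        mutually_independent (fun (ki : 'I_n * 'I_m) w =>
          B (t ki.1.+1) w ki.2 0 - B (t ki.1) w ki.2 0)].

(* The sigma-algebra generated by [B s], s <= t, and the P-null sets; null sets
   need not be measurable, hence neither need the members of this family. *)
Definition completed_filtration (m : nat) (B : R -> Omega -> 'cV[R]_m) (t : R) :
    set (set Omega) :=
  <<s [set C | exists s (i : 'I_m) (E : set R),
        [/\ 0 <= s <= t, measurable E & C = (fun w => B s w i 0) @^-1` E]]
      `|` [set N | P.-negligible N] >>.

Definition adapted (T : R) (F : R -> set (set Omega)) (n : nat)
    (X : R -> Omega -> 'cV[R]_n) : Prop :=
  forall t, 0 <= t < T -> forall (i : 'I_n) (E : set R), measurable E ->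
    F t ((fun w => X t w i 0) @^-1` E).

(* Strong solution of dX = - (T - t)^-1 A X dt + Sigma dB on [0, T), X_0 = 0.
   The integrand of the stochastic integral is constant, so that integral is
   Sigma (B_t - B_0) by definition.  Path continuity makes the drift integrable
   over [0, t] for every t < T. *)
Definition strong_solution (T : R) (n m : nat) (A : 'M[R]_n)
    (Sigma : 'M[R]_(n, m)) (B : R -> Omega -> 'cV[R]_m)
    (X : R -> Omega -> 'cV[R]_n) : Prop :=
  [/\ adapted T (completed_filtration B) X,
      {ae P, forall w, {within `[0, T[, continuous (fun t => X t w)}},
      {ae P, forall w, X 0 w = 0}
    & {ae P, forall w, forall t, 0 <= t < T ->
        X t w =
        (\col_i \int[lebesgue_measure]_(s in `[0, t])
                  (- (T - s)^-1 * (A *m X s w) i 0))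
        + Sigma *m (B t w - B 0 w)}].

End Wiener.

Section Spectral.
Context (R : realType).

Definition ReSpec (n : nat) (A : 'M[R]_n) : set R :=
  [set complex.Re l | l in
    [set l : complex R | eigenvalue (map_mx (real_complex R) A) l]].

Definition spectral_factorization (d : nat) (A : 'M[R]_d.+1) (p : nat)
    (a : 'I_p -> R) (f : 'I_p -> {poly R}) : Prop :=
  mxminpoly A = \prod_(j < p) f j /\
  forall (j : 'I_p) (z : complex R),
    root (map_poly (real_complex R) (f j)) z -> complex.Re z = a j.

(* Ker (q(A)) for the action on column vectors ([kermx] is about rows). *)
Definition polyker (d : nat) (A : 'M[R]_d.+1) (q : {poly R}) :
    set 'cV[R]_d.+1 :=
  [set v | horner_mx A q *m v = 0].

(* The columns of [b] form a basis of [V]. *)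
Definition column_basis (n k : nat) (V : set 'cV[R]_n) (b : 'M[R]_(n, k)) :
    Prop :=
  row_free b^T /\ V = range (fun c : 'cV[R]_k => b *m c).

(* pi_j(x): the coordinates, in the basis [b j] of V_j = Ker (f_j(A)), of the
   component x_j of x = x_1 + ... + x_p. *)
Definition spectral_coord (d : nat) (A : 'M[R]_d.+1) (p : nat)
    (f : 'I_p -> {poly R}) (dim : 'I_p -> nat)
    (b : forall j, 'M[R]_(d.+1, dim j)) (j : 'I_p) (x : 'cV[R]_d.+1) :
    'cV[R]_(dim j) :=
  xget 0 [set c | exists y : 'I_p -> 'cV[R]_d.+1,
    [/\ forall k, polyker A (f k) (y k), x = \sum_(k < p) y k
      & y j = b j *m c]].

End Spectral.

(* Main.v *)
Require Import Defs.
From mathcomp Require Import all_boot all_order all_algebra.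
From mathcomp Require Import all_classical all_reals all_analysis.
From mathcomp Require Import complex measurable_realfun ring lra.
Import Order.TTheory GRing.Theory Num.Theory.
Import numFieldNormedType.Exports.
Local Open Scope classical_set_scope.
Local Open Scope ring_scope.
Set Implicit Arguments.
Unset Strict Implicit.
Unset Printing Implicit Defensive.

(* In the time scale s = ln (T / (T - t)) the equation becomes autonomous: along
   a row u with u A = l u + u' (l = a + i b complex), the process x = u X satisfies
   dx = - (l x + u' X) ds + dn with noise n = u Sigma B.

   Upper bound. By dyadic chaining, B converges at T with |B_T - B| = O(e^(-k s))
   for every k < 1/2.  Subtracting the noise turns the equation into an ordinary
   differential equation, and the rate k < min(a, 1/2) passes from u' X to u X.
   Each row of pi_j is killed by the product of the A - l over the roots l of f_j,
   so an induction on the list of these roots bounds the j-th component.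

   Lower bound. A left eigenrow u of A whose eigenvalue has real part a_j vanishes
   on the other V_k, so |u X| is bounded by a multiple of the norm of X^[j].
   - |u X| = O(e^(-(1/2 + eps) s)) would make the increments of n over unit steps of
     s that small too, whereas they are Gaussian of order e^(-s/2).
   - If a_j < 1/2, then Q = Re (e^(l s) x) = Re \int e^(l r) dn_r converges, and it
     remains to see that its limit is almost surely nonzero.  The limit is
     approximated by the increment of n over a short initial interval [0, s], up to
     o(sqrt s), plus weighted increments independent of it, so the probability of
     {lim Q = 0} is at most that of a Gaussian of order sqrt s falling in a
     (random, but independent) interval of length O(de sqrt s), that is O(de). *)

(** * Ordinary differential equations with exponential rates *)

Section Deterministic.
Context {R : realType}.
Implicit Types f g df : R -> R.

Lemma mean_value_le f df (K s t : R) : s <= t -> continuous f ->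
  (forall r, s < r < t -> is_derive r 1 f (df r)) ->
  (forall r, s < r < t -> `|df r| <= K) ->
  `|f t - f s| <= K * (t - s).
Proof.
rewrite le_eqVlt => /predU1P[<-|st] cf fd dfK.
  by rewrite !subrr normr0 mulr0.
have fd' r : r \in `]s, t[ -> is_derive r 1 f (df r) by rewrite in_itv; exact: fd.
have [r /[!in_itv] rst ->] := MVT st fd' (continuous_subspaceT cf).
by rewrite normrM (@ger0_norm _ (t - s)) ?subr_ge0 ?(ltW st)// ler_wpM2r ?subr_ge0 ?(ltW st)// dfK// rst.
Qed.

Lemma derive_le0_nonincreasing f df (s t : R) : s <= t -> continuous f ->
  (forall r, s < r < t -> is_derive r 1 f (df r)) ->
  (forall r, s < r < t -> df r <= 0) -> f t <= f s.
Proof.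
rewrite le_eqVlt => /predU1P[<-//|st] cf fd df0.
have fd' r : r \in `]s, t[ -> is_derive r 1 f (df r) by rewrite in_itv; exact: fd.
have [r /[!in_itv] rst E] := MVT st fd' (continuous_subspaceT cf).
by rewrite -subr_le0 E; apply: mulr_le0_ge0; [exact: df0|rewrite subr_ge0 ltW].
Qed.

Lemma is_derive_expM (k r : R) :
  is_derive r 1 (fun t => expR (k * t)) (k * expR (k * r)).
Proof.
have : is_derive r 1 (fun t => k * t) k.
  by apply: is_derive_eq; rewrite scaler1.
move=> H; have := is_derive1_comp (is_derive_expR (k * r)) H.
by rewrite mulrC.
Qed.

Lemma continuous_expM (k : R) : continuous (fun t => expR (k * t)).
Proof.
move=> r; apply: (@continuous_comp R R R (fun t => k * t) expR).
  exact: mulrl_continuous.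
exact: continuous_expR.
Qed.

(** The limit is the supremum of the lower bounds [f s - g s]: the hypothesis at the earlier of two
    times puts each of them below every upper bound [f t + g t]. *)
Lemma cauchy_rate f g (s0 : R) :
  (forall s t, s0 <= s -> s <= t -> `|f t - f s| <= g s) ->
  exists l, forall s, s0 <= s -> `|f s - l| <= g s.
Proof.
move=> fg.
pose E := [set f s - g s | s in [set s | s0 <= s]].
have ubE t : s0 <= t -> ubound E (f t + g t).
  move=> s0t _ [s /= s0s <-].
  have gs0 := le_trans (normr_ge0 _) (fg s s s0s (lexx s)).
  have gt0 := le_trans (normr_ge0 _) (fg t t s0t (lexx t)).
  have [st|/ltW ts] := leP s t.
    by have := fg s t s0s st; rewrite ler_norml; lra.
  by have := fg t s s0t ts; rewrite ler_norml; lra.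
have E0 : E !=set0 by exists (f s0 - g s0); exists s0 => /=.
exists (sup E) => s s0s.
have h1 : sup E <= f s + g s by apply: ge_sup => //; exact: ubE.
have h2 : f s - g s <= sup E.
  by apply: ub_le_sup; [exists (f s0 + g s0); exact: ubE | exists s].
by rewrite ler_norml; lra.
Qed.

(** The function [K / p * expR (- p * r)] has as slope minus the bound on [df], so adding it to [f]
    or to [- f] gives nonincreasing functions; comparing end values yields both sides of the
    estimate. *)
Lemma exp_derive_rate f df (K p s0 : R) : 0 < p -> continuous f ->
  (forall r, s0 < r -> is_derive r 1 f (df r)) ->
  (forall r, s0 < r -> `|df r| <= K * expR (- p * r)) ->
  forall s t, s0 <= s -> s <= t -> `|f t - f s| <= K / p * expR (- p * s).
Proof.
move=> p0 cf fd dfK s t s0s st.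
have ed (r : R) : is_derive r 1 (fun t => K / p * expR (- p * t)) (- (K * expR (- p * r))).
  apply: is_derive_eq (is_deriveZ (K / p) (is_derive_expM (- p) r)) _.
  by rewrite /GRing.scale /=; field; rewrite gt_eqF.
have ce : continuous (fun t => K / p * expR (- p * t)).
  move=> r; apply: cvgM; [exact: cvg_cst | exact: continuous_expM].
have K0 : 0 <= K.
  by have := le_trans (normr_ge0 _) (dfK (s0 + 1) _); rewrite ltrDl ltr01;
     move=> /(_ isT); rewrite pmulr_lge0 ?expR_gt0.
have eK0 r : 0 <= K / p * expR (- p * r).
  by rewrite mulr_ge0 ?expR_ge0 ?divr_ge0 ?(ltW p0).
have up : f t + K / p * expR (- p * t) <= f s + K / p * expR (- p * s).
  apply: (@derive_le0_nonincreasing (fun t => f t + K / p * expR (- p * t))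
    (fun r => df r + - (K * expR (- p * r))) s t st).
  - by move=> r; apply: cvgD; [exact: cf|exact: ce].
  - by move=> r /andP[sr _]; exact: is_deriveD (fd _ (le_lt_trans s0s sr)) (ed r).
  - move=> r /andP[sr _]; rewrite subr_le0.
    exact: le_trans (ler_norm _) (dfK _ (le_lt_trans s0s sr)).
have dn : - f t + K / p * expR (- p * t) <= - f s + K / p * expR (- p * s).
  apply: (@derive_le0_nonincreasing (fun t => - f t + K / p * expR (- p * t))
    (fun r => - df r + - (K * expR (- p * r))) s t st).
  - by move=> r; apply: cvgD; [apply: cvgN; exact: cf|exact: ce].
  - move=> r /andP[sr _].
    exact: is_deriveD (is_deriveN (fd _ (le_lt_trans s0s sr))) (ed r).
  - move=> r /andP[sr _]; rewrite subr_le0; apply: le_trans (ler_norm _) _.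
    by rewrite normrN; exact: dfK (le_lt_trans s0s sr).
by rewrite ler_norml; have := eK0 t; lra.
Qed.

(* The Lyapunov function |y|^2 e^(2 kap t) relaxes at rate p = a - kap to a bounded level,
   whence W is nonincreasing. *)
Lemma rotation_ode_decay (a b kap C s0 n1 n2 : R) (f1 f2 x1 x2 g1 g2 : R -> R) :
  kap < a -> continuous f1 -> continuous f2 ->
  (forall r, s0 < r -> is_derive r 1 f1 (- (a * x1 r - b * x2 r + g1 r))) ->
  (forall r, s0 < r -> is_derive r 1 f2 (- (a * x2 r + b * x1 r + g2 r))) ->
  (forall r, s0 < r -> `|x1 r - f1 r - n1| <= C * expR (- kap * r)) ->
  (forall r, s0 < r -> `|x2 r - f2 r - n2| <= C * expR (- kap * r)) ->
  (forall r, s0 < r -> `|g1 r| <= C * expR (- kap * r)) ->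
  (forall r, s0 < r -> `|g2 r| <= C * expR (- kap * r)) ->
  exists K s1, forall r, s1 <= r ->
    `|x1 r| <= K * expR (- kap * r) /\ `|x2 r| <= K * expR (- kap * r).
Proof.
move=> kapa cf1 cf2 df1 df2 h1C h2C g1C g2C.
have [p p0 pE] : exists2 p : R, 0 < p & p = a - kap by exists (a - kap) => //; lra.
(* With y = f + n and x = y + (x - f - n) the equations become y1' = - (a y1 - b y2 + G1) and y2' =
   - (a y2 + b y1 + G2), where |G1|, |G2| <= D e^(- kap r). [K] is chosen so that its term in the
   derivative of [W] absorbs the remainders G1^2 / p and G2^2 / p. *)
pose D := (`|a| + `|b| + 1) * C.
pose K := 2 * D ^+ 2 / p ^+ 2.
pose W r := ((f1 r + n1) ^+ 2 + (f2 r + n2) ^+ 2) * expR ((2 * kap + p) * r)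
            - K * expR (p * r).
pose G1 r := a * (x1 r - f1 r - n1) - b * (x2 r - f2 r - n2) + g1 r.
pose G2 r := a * (x2 r - f2 r - n2) + b * (x1 r - f1 r - n1) + g2 r.
have GD (u v w e : R) : `|u| <= C * e -> `|v| <= C * e -> `|w| <= C * e ->
    `|a * u + b * v + w| <= D * e /\ `|a * u - b * v + w| <= D * e.
  move=> uC vC wC; rewrite /D.
  have -> : (`|a| + `|b| + 1) * C * e = `|a| * (C * e) + `|b| * (C * e) + C * e by ring.
  split; apply: le_trans (ler_normD _ _) _; apply: lerD => //.
    by apply: le_trans (ler_normD _ _) _; rewrite !normrM lerD ?ler_wpM2l.
  by apply: le_trans (ler_normB _ _) _; rewrite !normrM lerD ?ler_wpM2l.
(* The rotation terms in b cancel in the derivative of y1^2 + y2^2, and 2 kap + p - 2 a = - p. *)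
have W' r : s0 < r -> is_derive r 1 W
    (expR ((2 * kap + p) * r) *
       (- p * ((f1 r + n1) ^+ 2 + (f2 r + n2) ^+ 2)
        - 2 * ((f1 r + n1) * G1 r + (f2 r + n2) * G2 r))
     - K * p * expR (p * r)).
  move=> s0r.
  have := df1 _ s0r; have := df2 _ s0r => d2 d1.
  have e1 := is_derive_expM (2 * kap + p) r.
  have e2 := is_derive_expM p r.
  have y1 : is_derive r 1 (fun r => f1 r + n1) (- (a * x1 r - b * x2 r + g1 r)).
    by apply: is_derive_eq; rewrite addr0.
  have y2 : is_derive r 1 (fun r => f2 r + n2) (- (a * x2 r + b * x1 r + g2 r)).
    by apply: is_derive_eq; rewrite addr0.
  have := is_deriveB (is_deriveM (is_deriveD (is_deriveX 2 y1) (is_deriveX 2 y2)) e1)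
    (is_deriveZ K e2).
  move=> H; apply: is_derive_eq H _.
  rewrite /GRing.scale /= /G1 /G2 !expr1 pE.
  rewrite -[(_ ^+ 2 + _ ^+ 2) r]/((f1 r + n1) ^+ 2 + (f2 r + n2) ^+ 2); ring.
have W'0 r : s0 < r -> (expR ((2 * kap + p) * r) *
       (- p * ((f1 r + n1) ^+ 2 + (f2 r + n2) ^+ 2)
        - 2 * ((f1 r + n1) * G1 r + (f2 r + n2) * G2 r))
     - K * p * expR (p * r)) <= 0.
  move=> s0r.
  have [_ G1D] := GD _ _ _ _ (h1C _ s0r) (h2C _ s0r) (g1C _ s0r).
  have [G2D _] := GD _ _ _ _ (h2C _ s0r) (h1C _ s0r) (g2C _ s0r).
  rewrite -/(G1 r) -/(G2 r) in G1D G2D.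
  have E0E : expR (p * r) = expR ((2 * kap + p) * r) * expR (- kap * r) ^+ 2.
    by rewrite expr2 -!expRD; congr expR; ring.
  move: (G1 r) (G2 r) (f1 r + n1) (f2 r + n2) G1D G2D => u1 u2 y1 y2 u1D u2D.
  have sq (u : R) : `|u| <= D * expR (- kap * r) -> u ^+ 2 <= D ^+ 2 * expR (- kap * r) ^+ 2.
    by move=> uD; rewrite -exprMn -real_normK ?num_real// lerXn2r ?nnegrE// (le_trans _ uD).
  have {u1D}u1D := sq _ u1D; have {u2D}u2D := sq _ u2D.
  rewrite E0E mulrCA -mulrBr; apply: mulr_ge0_le0; first exact: expR_ge0.
  move: (expR (- kap * r) ^+ 2) u1D u2D => e u1D u2D.
  have ys (y u : R) : - p * y ^+ 2 - 2 * (y * u) <= u ^+ 2 / p.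
    have -> : u ^+ 2 / p = - p * y ^+ 2 - 2 * (y * u) + (p * y + u) ^+ 2 / p.
      by field; rewrite gt_eqF.
    by rewrite lerDl divr_ge0 ?sqr_ge0 ?ltW.
  have up (u : R) : u ^+ 2 <= D ^+ 2 * e -> u ^+ 2 / p <= D ^+ 2 * e / p.
    by move=> ?; apply: ler_wpM2r => //; rewrite invr_ge0 ltW.
  have -> : K * p * e = D ^+ 2 * e / p + D ^+ 2 * e / p.
    by rewrite /K; field; rewrite gt_eqF.
  have := ys y1 u1; have := ys y2 u2; have := up _ u1D; have := up _ u2D; lra.
have cW : continuous W.
  have cy f n : continuous f -> continuous (fun r => (f r + n) ^+ 2).
    move=> cf r; apply: (@continuous_comp _ _ _ (fun r => f r + n) (fun y => y ^+ 2)).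
      by apply: cvgD; [exact: cf|exact: cvg_cst].
    exact: sqr_continuous.
  move=> r; apply: cvgB; last by apply: cvgM; [exact: cvg_cst|exact: continuous_expM].
  apply: cvgM; last exact: continuous_expM.
  by apply: cvgD; exact: cy.
(* Strictly beyond [s0], where the derivatives are known, and nonnegative, so that e^(p r) >= 1
   absorbs the constant [W s1]. *)
pose s1 := Num.max 0 (s0 + 1).
have s1_0 : 0 <= s1 by rewrite /s1 le_max lexx.
have s01 : s0 < s1 by rewrite /s1 lt_max; apply/orP; right; lra.
pose M := K + `|W s1|.
have K0 : 0 <= K by apply: divr_ge0; [apply: mulr_ge0; [lra|exact: sqr_ge0]|exact: sqr_ge0].
have M0 : 0 <= M by rewrite /M addr_ge0.
exists (M + 1 + C), s1 => r s1r.
have s0r := lt_le_trans s01 s1r.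
have Wr : W r <= W s1.
  apply: (derive_le0_nonincreasing s1r cW) => q /andP[s1q _].
  - exact/W'/(lt_trans s01).
  - exact/W'0/(lt_trans s01).
have yM : (f1 r + n1) ^+ 2 + (f2 r + n2) ^+ 2 <= M * expR (- kap * r) ^+ 2.
  have Ep := expR_gt0 (p * r).
  have : ((f1 r + n1) ^+ 2 + (f2 r + n2) ^+ 2) * expR ((2 * kap + p) * r)
          <= M * expR (p * r).
    rewrite /M [leRHS]mulrDl -lerBlDl; apply: le_trans Wr _.
    apply: le_trans (ler_norm _) _; rewrite ler_peMr// -expR0 ler_expR.
    by rewrite mulr_ge0 ?(le_trans s1_0 s1r)// ltW.
  have -> : expR (p * r) = expR (- kap * r) ^+ 2 * expR ((2 * kap + p) * r).
    by rewrite expr2 -!expRD; congr expR; ring.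
  by rewrite mulrA ler_pM2r ?expR_gt0.
have y1M (y : R) : y ^+ 2 <= M * expR (- kap * r) ^+ 2 ->
    `|y| <= (M + 1) * expR (- kap * r).
  move=> yM'; rewrite -(@ler_pXn2r _ 2) ?nnegrE ?mulr_ge0 ?expR_ge0 ?addr_ge0//.
  rewrite real_normK ?num_real// exprMn; apply: le_trans yM' _.
  rewrite ler_wpM2r ?sqr_ge0// sqrrD; have := sqr_ge0 M; lra.
have f1s := sqr_ge0 (f1 r + n1); have f2s := sqr_ge0 (f2 r + n2).
have b1 : `|f1 r + n1| <= (M + 1) * expR (- kap * r) by apply: y1M; lra.
have b2 : `|f2 r + n2| <= (M + 1) * expR (- kap * r) by apply: y1M; lra.
split; rewrite mulrDl.
  have -> : x1 r = (f1 r + n1) + (x1 r - f1 r - n1) by ring.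
  by apply: le_trans (ler_normD _ _) _; apply: lerD => //; exact: h1C.
have -> : x2 r = (f2 r + n2) + (x2 r - f2 r - n2) by ring.
by apply: le_trans (ler_normD _ _) _; apply: lerD => //; exact: h2C.
Qed.

Lemma expR_small (c M : R) : 0 < c -> exists s0, forall s, s0 <= s -> M * expR (- s) <= c.
Proof.
move=> c0; exists (M / c) => s.
rewrite ler_pdivrMr// => Ms; rewrite expRN ler_pdivrMr ?expR_gt0//.
apply: le_trans Ms _; rewrite mulrC ler_pM2l//.
by apply: le_trans (expR_ge1Dx s); rewrite lerDr.
Qed.

End Deterministic.

(** * Riemann sums for the rotated process *)

Section Riemann.
Context {R : realType}.

(** Compactness of [0, J] in its near-covering form makes the pointwise radii uniform; half of each
    radius is spent on moving the centre. *)
Lemma uniform_continuous_itv (f : R -> R) (J e : R) : continuous f -> 0 < e ->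
  exists2 d, 0 < d & forall s t, 0 <= s <= J -> `|s - t| < d -> `|f s - f t| < e.
Proof.
move=> cf e0.
have := @segment_compact R 0 J; rewrite compact_near_coveringP.
pose Pr (d s : R) := forall t, `|s - t| < d -> `|f s - f t| < e.
move=> /(_ R (0:R)^'+ Pr _) cov.
have : \forall d \near 0^'+, forall s, `[0, J]%classic s -> Pr d s.
  apply: cov => s sJ.
  have e20 : 0 < e / 2 by rewrite divr_gt0.
  have /cvgrPdist_lt /(_ _ e20) /nbhs_ballP[r /= r0 rf] := cf s.
  have r20 : 0 < r / 2 by rewrite divr_gt0.
  exists (ball s (r / 2), [set d | d < r / 2]) => /=.
    split; first exact: nbhsx_ballx.
    exact: nbhs_right_lt.
  move=> [s' d] /= [ss' dr] t s't.
  rewrite /ball /= in ss'.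
  have h1 : `|f s - f s'| < e / 2.
    by apply: rf; rewrite /ball /=; apply: lt_trans ss' _; lra.
  have h2 : `|f s - f t| < e / 2.
    apply: rf; rewrite /ball /=.
    have -> : s - t = (s - s') + (s' - t) by ring.
    by apply: le_lt_trans (ler_normD _ _) _; lra.
  have -> : f s' - f t = (f s - f t) - (f s - f s') by ring.
  by apply: le_lt_trans (ler_normB _ _) _; lra.
move=> H.
have [d [d0 dP]] : exists d, 0 < d /\ forall s, `[0, J]%classic s -> Pr d s.
  near (0:R)^'+ => d; exists d; split => //.
  by near: d.
exists d => // s t sJ; apply: dP; rewrite /= in_itv /=; exact: sJ.
Unshelve. all: by end_near. Qed.

Lemma continuous_bounded_itv (f : R -> R) (J : R) : continuous f ->
  exists M, forall s, 0 <= s <= J -> `|f s| <= M.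
Proof.
move=> cf.
have [J0|J0] := leP 0 J; last by exists 0 => s; lra.
have [c _ cM] := @EVT_max R (fun s => `|f s|) 0 J J0
  (continuous_subspaceT (fun s => cvg_norm (cf s))).
by exists `|f c| => s sJ; apply: cM; rewrite in_itv.
Qed.

(** The three times are those of [rotated_increment]: there the derivative at r of a function built
    on the interval [s, t] is a combination of such differences. *)
Lemma uniform_product_itv (p q : R -> R) (J e : R) :
  continuous p -> continuous q -> 0 < e ->
  exists2 d, 0 < d & forall s r t, 0 <= s -> s <= r -> r <= t -> t <= J ->
    t - s < d -> `|p r * q t - p s * q r| < e.
Proof.
move=> cp cq e0.
have [Mp pM] := continuous_bounded_itv J cp.
have [Mq qM] := continuous_bounded_itv J cq.
pose M := `|Mp| + `|Mq| + 1.
have M0 : 0 < M by rewrite /M; have := normr_ge0 Mp; have := normr_ge0 Mq; lra.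
have eM : 0 < e / (2 * M) by rewrite divr_gt0 ?mulr_gt0.
have [d1 d10 dp] := uniform_continuous_itv J cp eM.
have [d2 d20 dq] := uniform_continuous_itv J cq eM.
exists (Num.min d1 d2) => [|s r t s0 sr rt tJ]; first by rewrite lt_min d10.
rewrite lt_min => /andP[td1 td2].
have -> : p r * q t - p s * q r = p r * (q t - q r) + q r * (p r - p s) by ring.
apply: le_lt_trans (ler_normD _ _) _; rewrite !normrM.
have h1 : `|p r| <= M.
  by apply: le_trans (pM r _) _; rewrite ?/M; have := ler_norm Mp; have := normr_ge0 Mq; lra.
have h2 : `|q r| <= M.
  by apply: le_trans (qM r _) _; rewrite ?/M; have := ler_norm Mq; have := normr_ge0 Mp; lra.
have h3 : `|q t - q r| < e / (2 * M).
  by apply: dq; [lra|rewrite ger0_norm; lra].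
have h4 : `|p r - p s| < e / (2 * M).
  by apply: dp; [lra|rewrite ger0_norm; lra].
have eE : e = M * (e / (2 * M)) + M * (e / (2 * M)) by field; rewrite gt_eqF.
rewrite [ltRHS]eE; apply: ltr_leD.
  apply: le_lt_trans (ler_wpM2r (normr_ge0 _) h1) _.
  by rewrite ltr_pM2l.
by apply: ler_pM => //; exact: ltW.
Qed.

(** [ecos] and [esin] are the real and imaginary parts of e^((a + i b) t). *)
Definition ecos (a b t : R) := expR (a * t) * cos (b * t).
Definition esin (a b t : R) := expR (a * t) * sin (b * t).

Lemma is_derive_linear (b t : R) : is_derive t 1 (fun u => b * u) b.
Proof. by apply: is_derive_eq; rewrite scaler1. Qed.

Lemma is_derive_ecos (a b t : R) :
  is_derive t 1 (ecos a b) (a * ecos a b t - b * esin a b t).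
Proof.
apply: is_derive_eq (is_deriveM (is_derive_expM a t)
  (is_derive1_comp (is_derive_cos (b * t)) (is_derive_linear b t))) _.
by rewrite /GRing.scale /= /ecos /esin; ring.
Qed.

Lemma is_derive_esin (a b t : R) :
  is_derive t 1 (esin a b) (a * esin a b t + b * ecos a b t).
Proof.
apply: is_derive_eq (is_deriveM (is_derive_expM a t)
  (is_derive1_comp (is_derive_sin (b * t)) (is_derive_linear b t))) _.
by rewrite /GRing.scale /= /ecos /esin; ring.
Qed.

Lemma continuous_ecos (a b : R) : continuous (ecos a b).
Proof.
move=> t; apply: differentiable_continuous; apply/derivable1_diffP.
by have [] := is_derive_ecos a b t.
Qed.

Lemma continuous_esin (a b : R) : continuous (esin a b).
Proof.
move=> t; apply: differentiable_continuous; apply/derivable1_diffP.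
by have [] := is_derive_esin a b t.
Qed.

Definition grid (s J : R) (N k : nat) : R := s + (J - s) * (k%:R / N.+1%:R).

Section Path.
Variables (a b : R) (x1 x2 f1 f2 : R -> R).
Hypotheses (cx1 : continuous x1) (cx2 : continuous x2).
Hypotheses (cf1 : continuous f1) (cf2 : continuous f2).
Hypothesis df1 : forall r : R, 0 < r -> is_derive r 1 f1 (- (a * x1 r - b * x2 r)).
Hypothesis df2 : forall r : R, 0 < r -> is_derive r 1 f2 (- (a * x2 r + b * x1 r)).
Let n1 (t : R) := x1 t - f1 t.
Let n2 (t : R) := x2 t - f2 t.
Let Q (t : R) := ecos a b t * x1 t - esin a b t * x2 t.

(* [Q] is the real part of e^((a + i b) t) (x1 + i x2), whose differential is
   e^((a + i b) t) d(n1 + i n2). *)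
Lemma rotated_increment (J e : R) : 0 < e ->
  exists2 d, 0 < d & forall s t, 0 <= s -> s <= t -> t <= J -> t - s < d ->
  `|Q t - Q s - (ecos a b s * (n1 t - n1 s) - esin a b s * (n2 t - n2 s))|
    <= e * (t - s).
Proof.
move=> e0.
pose c' (t : R) := a * ecos a b t - b * esin a b t.
pose s' (t : R) := a * esin a b t + b * ecos a b t.
have cc : continuous c'.
  by move=> t; apply: cvgB; apply: cvgM; try exact: cvg_cst;
    [exact: continuous_ecos | exact: continuous_esin].
have cs : continuous s'.
  by move=> t; apply: cvgD; apply: cvgM; try exact: cvg_cst;
    [exact: continuous_esin | exact: continuous_ecos].
have e20 : 0 < e / 2 by rewrite divr_gt0.
have [d1 d10 dc] := uniform_product_itv J cc cx1 e20.
have [d2 d20 ds] := uniform_product_itv J cs cx2 e20.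
exists (Num.min d1 d2) => [|s t s0 st tJ]; first by rewrite lt_min d10.
rewrite lt_min => /andP[td1 td2].
(* The noise is not differentiable, so only the smooth ingredients move with r: the weights against
   the end values of x, and the drift against the weights frozen at s. The two contributions to [dG]
   cancel when s = r = t, whence the smallness. *)
pose G (r : R) := ecos a b r * x1 t - esin a b r * x2 t
   + (ecos a b s * f1 r - esin a b s * f2 r).
pose dG (r : R) := (c' r * x1 t - c' s * x1 r) - (s' r * x2 t - s' s * x2 r).
have -> : Q t - Q s - (ecos a b s * (n1 t - n1 s) - esin a b s * (n2 t - n2 s)) = G t - G s.
  by rewrite /Q /G /n1 /n2; ring.
apply: (@mean_value_le R G dG); first exact: st.
- by move=> r; apply: cvgD; apply: cvgB; apply: cvgM; (try exact: cvg_cst);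
   [exact: continuous_ecos|exact: continuous_esin|exact: cf1|exact: cf2].
- move=> r /andP[sr rt]; have r0 := le_lt_trans s0 sr.
  have H := is_deriveD
   (is_deriveB (is_deriveM (is_derive_ecos a b r) (is_derive_cst (x1 t : R) (r : R) (1 : R)))
     (is_deriveM (is_derive_esin a b r) (is_derive_cst (x2 t : R) (r : R) (1 : R))))
   (is_deriveB (is_deriveZ (ecos a b s) (df1 r0)) (is_deriveZ (esin a b s) (df2 r0))).
  apply: is_derive_eq H _.
  by rewrite /GRing.scale /= /dG /c' /s'; ring.
- move=> r /andP[/ltW sr /ltW rt].
  apply: le_trans (ler_normB _ _) _.
  have := dc s r t s0 sr rt tJ td1; have := ds s r t s0 sr rt tJ td2; lra.
Qed.

(** By [rotated_increment] each left-point term errs by at most a small multiple of the step,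
    uniformly, and the increments of [Q] telescope. The stochastic integral is thus approximated
    path by path. *)
Lemma riemann_sum_cvg (s J e : R) : 0 <= s -> s <= J -> 0 < e ->
  exists N0 : nat, forall N : nat, (N0 <= N)%N ->
  `|Q J - Q s - \sum_(k < N.+1)
     (ecos a b (grid s J N k) * (n1 (grid s J N k.+1) - n1 (grid s J N k))
    - esin a b (grid s J N k) * (n2 (grid s J N k.+1) - n2 (grid s J N k)))| <= e.
Proof.
move=> s0 sJ e0.
(* The summand 1 keeps the denominator positive when s = J. *)
have e1 : 0 < e / (J - s + 1) by apply: divr_gt0 => //; lra.
have [d d0 dP] := rotated_increment J e1.
have [N0 N0d] : exists N0 : nat, (J - s) / d < N0%:R.
  exists (Num.Def.truncn ((J - s) / d)).+1.
  by apply: Num.Theory.truncnS_gt.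
exists N0 => N N0N.
have N1 : 0 < N.+1%:R :> R by rewrite ltr0n.
have Nd : (J - s) / N.+1%:R < d.
  rewrite ltr_pdivrMr// mulrC -ltr_pdivrMr//; apply: lt_trans N0d _.
  by rewrite ltr_nat ltnS.
have gE k : grid s J N k.+1 - grid s J N k = (J - s) / N.+1%:R.
  by rewrite /grid -natr1; field; rewrite addrC natr1 gt_eqF.
have tele : Q J - Q s = \sum_(k < N.+1) (Q (grid s J N k.+1) - Q (grid s J N k)).
  rewrite -(big_mkord xpredT (fun k => Q (grid s J N k.+1) - Q (grid s J N k))).
  rewrite telescope_sumr// /grid mul0r mulr0 addr0 divff ?gt_eqF// mulr1.
  by congr (Q _ - _); ring.
rewrite tele -sumrB; apply: le_trans (ler_norm_sum _ _ _) _.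
apply: (@le_trans _ _ (\sum_(k < N.+1) e / (J - s + 1) * ((J - s) / N.+1%:R))).
  apply: ler_sum => k _.
  have step0 : 0 <= (J - s) / N.+1%:R by apply: divr_ge0; [lra|exact: ltW].
  rewrite -(gE k); apply: dP; last by rewrite gE.
  - apply: le_trans s0 _; rewrite /grid lerDl; apply: mulr_ge0; first by lra.
    by rewrite divr_ge0.
  - by rewrite -subr_ge0 gE.
  - have kN : k.+1%:R / N.+1%:R <= 1 :> R.
      by rewrite ler_pdivrMr// mul1r ler_nat ltn_ord.
    have : (J - s) * (k.+1%:R / N.+1%:R) <= (J - s) * 1.
      by apply: ler_wpM2l => //; lra.
    by rewrite /grid mulr1; move: (_ * _) => y; lra.
rewrite sumr_const card_ord -[leLHS]mulr_natr.
have -> : e / (J - s + 1) * ((J - s) / N.+1%:R) * N.+1%:R = e * ((J - s) / (J - s + 1)).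
  by field; rewrite gt_eqF//=; lra.
apply: ler_piMr; first exact: ltW.
by rewrite ler_pdivrMr; lra.
Qed.

(** Replacing the noise by its limit turns [Q] into the differentiable function [F]. Both [Q - F]
    and the derivative of [F] are products of e^(a r) with the distance of the noise from its limit,
    hence of order e^(- (kap - a) r). *)
Lemma rotated_limit (kap C N1 N2 s0 : R) : a < kap -> 0 <= s0 ->
  (forall r, s0 < r -> `|n1 r - N1| <= C * expR (- kap * r)) ->
  (forall r, s0 < r -> `|n2 r - N2| <= C * expR (- kap * r)) ->
  exists l K, forall r, s0 < r -> `|Q r - l| <= K * expR (- (kap - a) * r).
Proof.
move=> ak s00 n1C n2C.
have p0 : 0 < kap - a by rewrite subr_gt0.
pose F r := ecos a b r * (f1 r + N1) - esin a b r * (f2 r + N2).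
pose dF r := - ((a * ecos a b r - b * esin a b r) * (n1 r - N1))
             + (a * esin a b r + b * ecos a b r) * (n2 r - N2).
pose K := 2 * (`|a| + `|b|) * C.
have ce r : `|ecos a b r| <= expR (a * r).
  by rewrite /ecos normrM gtr0_norm ?expR_gt0// ler_piMr ?expR_ge0// ler_norml cos_geN1 cos_le1.
have se r : `|esin a b r| <= expR (a * r).
  by rewrite /esin normrM gtr0_norm ?expR_gt0// ler_piMr ?expR_ge0// ler_norml sin_geN1 sin_le1.
have eE (r : R) : expR (- (kap - a) * r) = expR (a * r) * expR (- kap * r).
  by rewrite -expRD; congr expR; ring.
have cn (u v w z e f : R) : `|u| <= e -> `|v| <= e -> `|w| <= f ->
    `|(a * u - b * v) * w| <= (`|a| + `|b|) * e * f
    /\ `|(a * u + b * v) * w| <= (`|a| + `|b|) * e * f.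
  move=> ue ve wf; split; rewrite normrM; apply: ler_pM => //; rewrite mulrDl.
    by apply: le_trans (ler_normB _ _) _; rewrite !normrM lerD ?ler_wpM2l.
  by apply: le_trans (ler_normD _ _) _; rewrite !normrM lerD ?ler_wpM2l.
have dFK r : s0 < r -> `|dF r| <= K * expR (- (kap - a) * r).
  move=> s0r; rewrite /dF; apply: le_trans (ler_normD _ _) _; rewrite normrN.
  have [h1 _] := cn _ _ _ 0 _ _ (ce r) (se r) (n1C _ s0r).
  have [_ h2] := cn _ _ _ 0 _ _ (se r) (ce r) (n2C _ s0r).
  have -> : K * expR (- (kap - a) * r) =
    (`|a| + `|b|) * expR (a * r) * (C * expR (- kap * r)) +
    (`|a| + `|b|) * expR (a * r) * (C * expR (- kap * r)).
    by rewrite /K eE; ring.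
  exact: lerD.
have Fd (r : R) : s0 < r -> is_derive r 1 F (dF r).
  move=> s0r; have r0 := le_lt_trans s00 s0r.
  have y1 : is_derive r 1 (fun r => f1 r + N1) (- (a * x1 r - b * x2 r)).
    by have := df1 r0 => ?; apply: is_derive_eq; rewrite addr0.
  have y2 : is_derive r 1 (fun r => f2 r + N2) (- (a * x2 r + b * x1 r)).
    by have := df2 r0 => ?; apply: is_derive_eq; rewrite addr0.
  have H := is_deriveB (is_deriveM (is_derive_ecos a b r) y1)
    (is_deriveM (is_derive_esin a b r) y2).
  apply: is_derive_eq H _.
  by rewrite /GRing.scale /= /dF /n1 /n2; ring.
have cF : continuous F.
  by move=> r; apply: cvgB; apply: cvgM; (try (apply: cvgD; last exact: cvg_cst));
   [exact: continuous_ecos|exact: cf1|exact: continuous_esin|exact: cf2].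
have [l Fl] := cauchy_rate (exp_derive_rate p0 cF Fd dFK).
exists l, (2 * C + K / (kap - a)) => r s0r.
have -> : Q r - l = ecos a b r * (n1 r - N1) - esin a b r * (n2 r - N2) + (F r - l).
  by rewrite /Q /F /n1 /n2; ring.
rewrite mulrDl; apply: le_trans (ler_normD _ _) _; apply: lerD; last exact/Fl/ltW.
apply: le_trans (ler_normB _ _) _; rewrite eE.
have -> : 2 * C * (expR (a * r) * expR (- kap * r)) =
   expR (a * r) * (C * expR (- kap * r)) + expR (a * r) * (C * expR (- kap * r)).
  by ring.
have le2 (u v x y : R) : `|u| <= x -> `|v| <= y -> `|u * v| <= x * y.
  by move=> ux vy; rewrite normrM ler_pM.
by apply: lerD; apply: le2; [exact: ce|exact: n1C|exact: se|exact: n2C].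
Qed.

End Path.
End Riemann.

(** * Gaussian estimates *)

Section Normal.
Context {R : realType}.
Local Notation mu := (@lebesgue_measure R).

(** The density is at most its peak 1 / (sg sqrt (2 pi)), hence at most 1 / sg. *)
Lemma normal_prob_itv_le (sg x y : R) : 0 < sg -> x <= y ->
  (normal_prob 0 sg `[x, y] <= ((y - x) / sg)%:E)%E.
Proof.
move=> sg0 xy; rewrite /normal_prob.
have pi1 : 1 <= pi *+ 2 :> R by have := pi_ge2 R; lra.
have pk : normal_peak sg <= sg^-1.
  have s2 : 0 < sg ^+ 2 by rewrite exprn_gt0.
  have h : sg ^+ 2 <= sg ^+ 2 * pi *+ 2 by rewrite -mulrnAr; apply: ler_peMr => //; exact: ltW.
  rewrite /normal_peak lef_pV2 ?posrE ?sqrtr_gt0// ?(lt_le_trans s2)//.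
  by rewrite -[leLHS]gtr0_norm// -sqrtr_sqr ler_wsqrtr.
apply: (@le_trans _ _ (\int[mu]_(t in `[x, y]) (cst (sg^-1)%:E t))%E).
  apply: ge0_le_integral => //=.
  - by move=> t _; rewrite lee_fin normal_pdf_ge0.
  - apply/measurable_EFinP; apply: measurable_funTS; exact: measurable_normal_pdf.
  - move=> t _; rewrite lee_fin; apply: le_trans pk; apply: normal_pdf_ub.
    by rewrite gt_eqF.
rewrite integral_cst//= lebesgue_measure_itv/= lte_fin.
case: ltP => xy'; first by rewrite -EFinB -EFinM lee_fin mulrC.
by rewrite mule0 lee_fin divr_ge0 ?subr_ge0 ?(ltW sg0).
Qed.

(* On |y| > x the density is at most sqrt 2 exp (- x^2 / (4 sg^2)) times the
   normal density of variance 2 sg^2. *)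
Lemma normal_prob_tail_le (sg x : R) : 0 < sg -> 0 <= x ->
  (normal_prob 0 sg [set y | (x < `|y|)%R] <=
   (Num.sqrt 2 * expR (- (x ^+ 2 / (4 * sg ^+ 2))))%:E)%E.
Proof.
move=> sg0 x0; rewrite /normal_prob.
pose k := Num.sqrt 2 * expR (- (x ^+ 2 / (4 * sg ^+ 2))).
have k0 : 0 <= k by rewrite mulr_ge0 ?expR_ge0.
pose sg' := Num.sqrt 2 * sg.
have sg'0 : 0 < sg' by rewrite mulr_gt0// sqrtr_gt0.
have mD : measurable [set y : R | x < `|y|].
  rewrite [X in measurable X](_ : _ = (fun y : R => `|y|) @^-1` `]x, +oo[).
    by rewrite -[X in measurable X]setTI; exact: (normr_measurable measurableT).
  by apply/seteqP; split => y /=; rewrite in_itv /= andbT.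
have mp s : measurable_fun setT (fun y : R => (normal_pdf 0 s y)%:E).
  by apply/measurable_EFinP; exact: measurable_normal_pdf.
apply: (@le_trans _ _ (\int[mu]_(t in [set y | (x < `|y|)%R]) (k%:E * (normal_pdf 0 sg' t)%:E))%E).
  apply: ge0_le_integral => //=.
  - by move=> t _; rewrite lee_fin normal_pdf_ge0.
  - apply: measurable_funTS; exact: mp.
  - by apply: measurable_funeM; apply: measurable_funTS; exact: mp.
  - move=> t xt; rewrite lee_fin !normal_pdfE ?gt_eqF// /normal_peak /normal_fun.
    rewrite !subr0.
    have s2 : sg' ^+ 2 = 2 * sg ^+ 2 by rewrite exprMn sqr_sqrtr.
    have v0 : 0 <= sg ^+ 2 * pi *+ 2 by rewrite mulrn_wge0// mulr_ge0 ?sqr_ge0 ?pi_ge0.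
    have -> : Num.sqrt (sg' ^+ 2 * pi *+ 2) = Num.sqrt 2 * Num.sqrt (sg ^+ 2 * pi *+ 2).
      by rewrite -sqrtrM// s2; congr Num.sqrt; ring.
    rewrite s2 /k [(Num.sqrt 2 * _)^-1]invfM.
    have -> : Num.sqrt 2 * expR (- (x ^+ 2 / (4 * sg ^+ 2))) *
      ((Num.sqrt 2)^-1 * (Num.sqrt (sg ^+ 2 * pi *+ 2))^-1 * expR (- t ^+ 2 / (2 * sg ^+ 2 *+ 2)))
      = (Num.sqrt (sg ^+ 2 * pi *+ 2))^-1 * (expR (- (x ^+ 2 / (4 * sg ^+ 2))) * expR (- t ^+ 2 / (2 * sg ^+ 2 *+ 2))).
      by field; rewrite ?gt_eqF ?sqrtr_gt0// mulrn_wgt0// mulr_gt0 ?exprn_gt0 ?pi_gt0.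
    apply: ler_wpM2l; first by rewrite invr_ge0 sqrtr_ge0.
    rewrite -expRD ler_expR.
    have xt2 : x ^+ 2 <= t ^+ 2.
      by rewrite -(real_normK (num_real t)) lerXn2r ?nnegrE// ltW.
    have -> : - t ^+ 2 / (sg ^+ 2 *+ 2) = - (t ^+ 2 / (4 * sg ^+ 2)) + - t ^+ 2 / (2 * sg ^+ 2 *+ 2).
      by field; rewrite gt_eqF.
    by rewrite lerD2r lerN2 ler_wpM2r// invr_ge0 mulr_ge0// sqr_ge0.
rewrite [leLHS](_ : _ = (k%:E * \int[mu]_(t in [set y | (x < `|y|)%R]) (normal_pdf 0 sg' t)%:E)%E); last first.
  apply: ge0_integralZl_EFin => //.
  - by move=> t _; rewrite lee_fin normal_pdf_ge0.
  - apply: measurable_funTS; exact: mp.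
rewrite -[leRHS]mule1; apply: lee_wpmul2l; first by rewrite lee_fin.
rewrite -(integral_normal_pdf 0 sg').
apply: ge0_subset_integral => //; first exact: mp.
by move=> t _; rewrite lee_fin normal_pdf_ge0.
Qed.

End Normal.

Section Anticoncentration.
Context (R : realType) (dsp : measure_display) (Omega : measurableType dsp).
Variable P : probability Omega R.

Lemma measurable_preimage (X : Omega -> R) (E : set R) :
  measurable_fun setT X -> measurable E -> measurable (X @^-1` E).
Proof. by move=> mX mE; rewrite -[X in measurable X]setTI; exact: mX. Qed.

(* The other variables are discretized on a grid so fine that, on each cell, the sum
   is within 2 e of an affine function of Y i0. *)
Lemma anticoncentration (I : finType) (Y : I -> Omega -> R) (i0 : I) (L e : R)
    (c : I -> R) :
  (forall i, measurable_fun setT (Y i)) -> mutually_independent P Y ->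
  (forall x y, x <= y -> (P (Y i0 @^-1` `[x, y]) <= (L * (y - x))%:E)%E) ->
  c i0 != 0 -> 0 < e ->
  (P [set w | (`|\sum_i c i * Y i w| <= e)%R] <= (4 * L * e / `|c i0|)%:E)%E.
Proof.
move=> mY indY YL c0 e0.
have nc0 : 0 < `|c i0| by rewrite normr_gt0.
have L0 : 0 <= L.
  have := YL 0 1 ler01; rewrite subr0 mulr1 => /(le_trans (measure_ge0 _ _)).
  by rewrite lee_fin.
pose S : R := \sum_(i | i != i0) `|c i|.
have S0 : 0 <= S by apply: sumr_ge0.
(* [h] is the mesh of the grid: rounding every variable except [Y i0] changes the sum by at most
   [S * h]. *)
have [h h0 Sh] : exists2 h : R, 0 < h & S * h <= e.
  exists (e / (S + 1)); first by rewrite divr_gt0//; lra.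
  by rewrite mulrCA ler_piMr ?(ltW e0)// ler_pdivrMr; lra.
(* The variable [Y i0] is not discretized: its cell is the whole line for [k i0 = 0] and empty for
   the other values, which keeps the cells disjoint although [k] is indexed by all of [I]. *)
pose E (k : {ffun I -> int}) (i : I) : set R :=
  if i == i0 then (if k i0 == 0 then setT else set0)
  else `[(k i)%:~R * h, ((k i)%:~R + 1) * h[%classic.
pose m (k : {ffun I -> int}) := \sum_(i | i != i0) c i * ((k i)%:~R * h).
(* On cell [k] the event forces |c_i0 Y_i0 + m k| <= 2 e: one e from the event, one from
   rounding. *)
pose J k : set R := `[- m k / c i0 - 2 * e / `|c i0|, - m k / c i0 + 2 * e / `|c i0|]%classic.
pose E' k i := if i == i0 then E k i `&` J k else E k i.
pose B k := \bigcap_(i in [set: I]) (Y i @^-1` E k i).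
pose B' k := \bigcap_(i in [set: I]) (Y i @^-1` E' k i).
have mE k i : measurable (E k i).
  by rewrite /E; case: eqP => _ //; case: eqP.
have mE' k i : measurable (E' k i).
  by rewrite /E'; case: ifP => // _; apply: measurableI => //; exact: measurable_itv.
have mB k : measurable (B k).
  apply: fin_bigcap_measurable => [|i _]; first exact: finite_finset.
  exact: measurable_preimage.
have mB' k : measurable (B' k).
  apply: fin_bigcap_measurable => [|i _]; first exact: finite_finset.
  exact: measurable_preimage.
pose M := 4 * L * e / `|c i0|.
have M0 : 0 <= M by rewrite divr_ge0 ?mulr_ge0 ?(ltW e0)//.
(* By independence both probabilities are products that differ only in the factor of [i0], which is
   1 or 0 for [B k]. *)
have B'B k : (P (B' k) <= M%:E * P (B k))%E.
  rewrite /B /B' !indY// (bigD1 i0)//= [X in (_ <= _ * X)%E](bigD1 i0)//=.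
  rewrite muleA; set p' := (\prod_(i | _) P _)%E; set p := (\prod_(i | _) P _)%E.
  have -> : p' = p by apply: eq_bigr => i /negbTE ii0; rewrite /E' ii0.
  have p0 : (0 <= p)%E by apply: prode_ge0 => i _; exact: measure_ge0.
  apply: lee_wpmul2r => //.
  rewrite /E' /E eqxx; case: eqP => _; last first.
    by rewrite set0I preimage_set0 measure0 mule0.
  rewrite setTI preimage_setT probability_setT mule1.
  apply: le_trans (YL _ _ _) _.
    by apply: lerD => //; rewrite ge0_cp// ?divr_ge0 ?mulr_ge0 ?(ltW e0).
  by rewrite lee_fin /M le_eqVlt; apply/orP; left; apply/eqP; field; rewrite gt_eqF.
(* Enumerates the countably many cells by natural numbers; codes of no cell get the empty set. *)
pose F (G : {ffun I -> int} -> set Omega) (n : nat) :=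
  if pickle_inv n is Some k then G k else set0.
have mF G : (forall k, measurable (G k)) -> forall n, measurable (F G n).
  by move=> mG n; rewrite /F; case: pickle_inv.
have triv : trivIset setT (F B).
  apply/trivIsetP => n1 n2 _ _; rewrite /F.
  have := @pickle_invK {ffun I -> int} n1; have := @pickle_invK {ffun I -> int} n2.
  case: pickle_inv => [k2|]; last by rewrite setI0.
  case: pickle_inv => [k1|]; last by rewrite set0I.
  move=> /= <- <- k12; rewrite -subset0 => w [/= b1 b2].
  case/eqP: k12; congr pickle; apply/ffunP => i.
  have {b1} := b1 i Logic.I; have {b2} := b2 i Logic.I; rewrite /= /E.
  have [->|_] := eqVneq i i0.
    by case: eqP => [->|//] _; case: eqP => [->|//].
  rewrite /= !in_itv /= => /andP[h1 h2] /andP[h3 h4].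
  have lek (a b : int) : a%:~R * h < (b%:~R + 1) * h -> (a <= b)%R.
    by rewrite ltr_pM2r// -[1 in X in _ < X]/(1%:~R) -intrD ltr_int ltzD1.
  by apply/eqP; rewrite eq_le !lek//; [exact: le_lt_trans h1 _|exact: le_lt_trans h3 _].
have cov : [set w | `|\sum_i c i * Y i w| <= e] `<=` \bigcup_n F B' n.
  move=> w /= Sw.
  pose k : {ffun I -> int} := [ffun i => if i == i0 then 0 else Num.floor (Y i w / h)].
  exists (pickle k) => //; rewrite /F pickleK_inv => i _ /=.
  have kY j : j != i0 -> (k j)%:~R * h <= Y j w < ((k j)%:~R + 1) * h.
    move=> /negbTE ji0; rewrite ffunE ji0 -ler_pdivlMr// -ltr_pdivrMr//.
    by rewrite floor_le_tmp -[1 in X in _ && X]/(1%:~R) -intrD floorD1_gt.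
  rewrite /E' /E; have [->|ii0] := eqVneq i i0; last first.
    by rewrite /= in_itv /= kY.
  rewrite {1}ffunE eqxx /=; split => //; rewrite /J /= in_itv /= -ler_distlC distrC.
  have -> : Y i0 w - - m k / c i0 = (c i0 * Y i0 w + m k) / c i0.
    by field.
  rewrite normrM normfV ler_pM2r ?invr_gt0//.
  rewrite (bigD1 i0)//= in Sw.
  have -> : c i0 * Y i0 w + m k = (c i0 * Y i0 w + \sum_(j | j != i0) c j * Y j w)
     - \sum_(j | j != i0) c j * (Y j w - (k j)%:~R * h).
    rewrite /m -addrA; congr (_ + _); rewrite -sumrB; apply: eq_bigr => j _; ring.
  apply: le_trans (ler_normB _ _) _.
  suff : `|\sum_(j | j != i0) c j * (Y j w - (k j)%:~R * h)| <= S * h by lra.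
  apply: le_trans (ler_norm_sum _ _ _) _; rewrite /S mulr_suml.
  apply: ler_sum => j ji0; rewrite normrM; apply: ler_wpM2l => //.
  have := kY _ ji0; rewrite ler_norml; lra.
have mA : measurable [set w | `|\sum_i c i * Y i w| <= e].
  have mS : measurable_fun setT (fun w => `|\sum_i c i * Y i w|).
    apply: measurableT_comp => //; apply: measurable_sum => i.
    by apply: measurable_funM.
  rewrite [X in measurable X](_ : _ = (fun w => `|\sum_i c i * Y i w|) @^-1` `]-oo, e]).
    exact: measurable_preimage.
  by apply/seteqP; split => w /=; rewrite in_itv.
apply: le_trans (measure_sigma_subadditive P (mF _ mB') mA cov) _.
apply: (@le_trans _ _ (\sum_(n <oo) M%:E * P (F B n))%E).
  apply: lee_nneseries => n *; first exact: measure_ge0.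
  rewrite /F; case: pickle_inv => [k|]; first exact: B'B.
  by rewrite !measure0 mule0.
rewrite nneseriesZl//.
rewrite -[leRHS]mule1; apply: lee_wpmul2l; first by rewrite lee_fin.
have <- : P (\bigcup_n F B n) = (\sum_(n <oo) P (F B n))%E.
  rewrite measure_bigcup//; last by move=> n _; exact: mF.
  by apply: eq_eseriesl => n; rewrite in_setT.
by apply: probability_le1; apply: bigcup_measurable => n _; exact: mF.
Qed.

End Anticoncentration.

(** * Regularity of Brownian paths at the terminal time *)

Section Liminf.
Context (R : realType) (dsp : measure_display) (Omega : measurableType dsp).
Variable P : probability Omega R.

Definition set_liminf (A : nat -> set Omega) : set Omega :=
  \bigcup_n \bigcap_(k in [set k | (n <= k)%N]) A k.

Lemma measurable_set_liminf (A : nat -> set Omega) :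
  (forall n, measurable (A n)) -> measurable (set_liminf A).
Proof.
move=> mA; apply: bigcup_measurable => n _.
by apply: bigcap_measurableType => k _.
Qed.

(** The intersections over k >= n increase with n to the limit inferior, and each lies in some [A k]
    with k >= N. *)
Lemma set_liminf_le (A : nat -> set Omega) (c : R) (N : nat) :
  (forall n, measurable (A n)) ->
  (forall n, (N <= n)%N -> (P (A n) <= c%:E)%E) -> (P (set_liminf A) <= c%:E)%E.
Proof.
move=> mA Ac; rewrite /set_liminf.
set D := fun n : nat => _.
have mD n : measurable (D n) by apply: bigcap_measurableType => k _.
have cvgD : (P \o D) n @[n --> \oo] --> P (\bigcup_n D n).
  apply: nondecreasing_cvg_mu => //; first exact: measurable_set_liminf.
  move=> n k nk; apply/subsetPset => w Dw i /= ki; apply: Dw => /=.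
  exact: leq_trans ki.
rewrite -(cvg_lim _ cvgD)//; apply: lime_le; first by apply/cvg_ex; eexists; exact: cvgD.
apply: nearW => n; apply: le_trans (Ac (maxn n N) (leq_maxr _ _)).
apply: le_measure; rewrite ?inE//.
by apply: bigcap_inf; rewrite /= leq_maxl.
Qed.

Lemma negligible_approx (N : set Omega) :
  (forall e : R, 0 < e -> exists A, [/\ measurable A, N `<=` A & (P A <= e%:E)%E]) ->
  P.-negligible N.
Proof.
move=> H.
have /choice[A AP] : forall n : nat, exists A, [/\ measurable A, N `<=` A & (P A <= (n.+1%:R^-1)%:E)%E].
  by move=> n; apply: H; rewrite invr_gt0.
exists (\bigcap_n A n); split.
- by apply: bigcap_measurableType => n _; have [] := AP n.
- apply/eqP; rewrite eq_le measure_ge0 andbT; apply/lee_addgt0Pr => e e0.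
  rewrite add0e.
  have [n ne] : exists n : nat, n.+1%:R^-1 <= e.
    exists (Num.Def.truncn e^-1); rewrite invf_ple ?posrE//.
    exact/ltW/truncnS_gt.
  have [mA _ An] := AP n.
  apply: le_trans (le_trans An _); last by rewrite lee_fin.
  apply: le_measure; rewrite ?inE//; last exact: bigcap_inf.
  by apply: bigcap_measurableType => k _; have [] := AP k.
- by move=> w Nw n _; have [_ + _] := AP n; apply.
Qed.

End Liminf.

Section Chaining.
Context (R : realType).

Definition dyadic (T : R) (n k : nat) : R := T * (k%:R / (2 ^ n)%:R).

Lemma within_continuous_dist (T t e : R) (b : R -> R) :
  {within `[0, T[, continuous b} -> 0 <= t < T -> 0 < e ->
  exists2 r, 0 < r & forall y, 0 <= y < T -> `|t - y| < r -> `|b t - b y| < e.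
Proof.
move=> /subspace_continuousP cb tT e0.
have /cvgrPdist_lt /(_ _ e0) := cb t tT.
rewrite near_withinE => /nbhs_ballP[r /= r0 rP].
by exists r => // y yT ty; apply: rP => //=; rewrite in_itv.
Qed.

(** Let [fl i] be the largest level-i dyadic point not exceeding t. Passing to level i + 1 either
    keeps it or moves it to the adjacent point, at cost q^(i + 1). The costs sum geometrically, and
    [fl i] tends to t, where b is continuous. *)
Lemma dyadic_chaining (T q : R) (b : R -> R) (N : nat) : 0 < T -> 0 < q < 1 ->
  {within `[0, T[, continuous b} ->
  (forall n k, (N <= n)%N -> (k.+1 < 2 ^ n)%N ->
    `|b (dyadic T n k.+1) - b (dyadic T n k)| <= q ^+ n) ->
  forall n t, (N <= n)%N -> T * (1 - ((2 ^ n)%:R)^-1) <= t < T ->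
    `|b t - b (T * (1 - ((2 ^ n)%:R)^-1))| <= q ^+ n / (1 - q).
Proof.
move=> T0 /andP[q0 q1] cb bq n t Nn /andP[nt tT].
have p2 i : 0 < (2 ^ i)%:R :> R by rewrite ltr0n expn_gt0.
have p2n i : (2 ^ i)%:R != 0 :> R by rewrite gt_eqF.
have q10 : 0 < 1 - q by rewrite subr_gt0.
have t0 : 0 <= t.
  apply: le_trans nt; rewrite mulr_ge0 ?(ltW T0)// subr_ge0 invf_le1//.
  by rewrite ler1n expn_gt0.
pose k i := Num.Def.truncn (t / T * (2 ^ i)%:R).
have ktr i : (k i)%:R <= t / T * (2 ^ i)%:R < (k i).+1%:R.
  by apply: truncn_itv; rewrite mulr_ge0 ?divr_ge0 ?(ltW T0)// ltW.
have klt i : (k i < 2 ^ i)%N.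
  have /andP[h _] := ktr i; rewrite -(ltr_nat R); apply: le_lt_trans h _.
  by rewrite gtr_pMl// ltr_pdivrMr// mul1r.
pose fl i := dyadic T i (k i).
have flle i : fl i <= t.
  have /andP[h _] := ktr i; rewrite /fl /dyadic.
  have -> : t = T * ((t / T * (2 ^ i)%:R) / (2 ^ i)%:R) by field; rewrite p2n gt_eqF.
  by rewrite ler_pM2l// ler_pM2r// invr_gt0.
have flgt i : t - fl i < T / (2 ^ i)%:R.
  have /andP[_ h] := ktr i; rewrite ltrBlDl /fl /dyadic.
  have -> : T * ((k i)%:R / (2 ^ i)%:R) + T / (2 ^ i)%:R = T * ((k i).+1%:R / (2 ^ i)%:R).
    by rewrite -natr1; field.
  have -> : t = T * ((t / T * (2 ^ i)%:R) / (2 ^ i)%:R) by field; rewrite p2n gt_eqF.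
  by rewrite ltr_pM2l// ltr_pM2r// invr_gt0.
have fl0 i : 0 <= fl i by rewrite /fl /dyadic !mulr_ge0// ?ltW// ?invr_gt0.
have step i : (N <= i.+1)%N -> `|b (fl i.+1) - b (fl i)| <= q ^+ i.+1.
  move=> Ni.
  have flE : fl i = dyadic T i.+1 (k i).*2.
    by rewrite /fl /dyadic expnS natrM -muln2 natrM; field.
  have : k i.+1 = (k i).*2 \/ k i.+1 = (k i).*2.+1.
    have /andP[h1 h2] := ktr i; have /andP[h3 h4] := ktr i.+1.
    rewrite expnS natrM in h3 h4.
    have l1 : ((k i).*2 < (k i.+1).+1)%N.
      rewrite -(ltr_nat R); apply: le_lt_trans h4; rewrite -muln2 natrM; lra.
    have l2 : (k i.+1 < (k i).+1.*2)%N.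
      rewrite -(ltr_nat R); apply: le_lt_trans h3 _; rewrite -muln2 natrM; lra.
    move: l1 l2; rewrite doubleS !ltnS => l1; rewrite leq_eqVlt => /orP[/eqP->|]; first by right.
    by rewrite ltnS => l2; left; apply/eqP; rewrite eqn_leq l1 l2.
  rewrite flE /fl => -[->|E]; first by rewrite subrr normr0 exprn_ge0 ?ltW.
  by rewrite E; apply: bq => //; rewrite -E; exact: klt.
have sum i : `|b (fl (n + i)%N) - b (fl n)| <= q ^+ n * (1 - q ^+ i) / (1 - q).
  elim: i => [|i IH]; first by rewrite addn0 expr0 !subrr mulr0 mul0r normr0.
  have -> : b (fl (n + i.+1)%N) - b (fl n) = (b (fl (n + i).+1) - b (fl (n + i)%N)) + (b (fl (n + i)%N) - b (fl n)).
    by rewrite addnS; ring.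
  apply: le_trans (ler_normD _ _) _.
  have := step (n + i)%N (leq_trans Nn (leq_trans (leq_addr _ _) (leqnSn _))).
  have : q ^+ (n + i).+1 <= q ^+ (n + i).
    by rewrite exprS ler_piMl ?exprn_ge0 ?ltW.
  have -> : q ^+ n * (1 - q ^+ i.+1) / (1 - q) = q ^+ (n + i) + q ^+ n * (1 - q ^+ i) / (1 - q).
    by rewrite exprS exprD; field; rewrite gt_eqF.
  move: IH; lra.
(* Every t of the last level-n cell starts its chain at the same point, so all these values are
   compared with one. *)
have fln : fl n = T * (1 - ((2 ^ n)%:R)^-1).
  suff kn : (k n).+1 = (2 ^ n)%N.
    by rewrite /fl /dyadic -[in RHS]kn -[in LHS]kn -natr1; field; rewrite natr1 gt_eqF.
  apply/eqP; rewrite eqn_leq klt /= -ltnS -(ltr_nat R) -natr1.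
  have /andP[_ h] := ktr n; apply: (@le_lt_trans _ _ (t / T * (2 ^ n)%:R + 1)); last by lra.
  have : (1 - ((2 ^ n)%:R)^-1) * (2 ^ n)%:R <= t / T * (2 ^ n)%:R.
    by rewrite ler_pM2r// ler_pdivlMr// mulrC.
  by rewrite mulrBl mul1r mulVf//; lra.
have small i : q ^+ n * (1 - q ^+ i) / (1 - q) <= q ^+ n / (1 - q).
  rewrite ler_wpM2r ?invr_ge0 ?(ltW q10)// ler_piMr ?exprn_ge0 ?(ltW q0)//.
  by rewrite gerBl exprn_ge0 ?ltW.
rewrite -fln; apply/ler_addgt0Pr => e e0.
have tI : 0 <= t < T by rewrite t0.
have [r r0 rP] := within_continuous_dist cb tI e0.
have [i ir] : exists i : nat, T / (2 ^ (n + i))%:R < r.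
  exists (Num.Def.truncn (T / r)).+1; rewrite ltr_pdivrMr// mulrC -ltr_pdivrMr//.
  apply: lt_le_trans (truncnS_gt _) _; rewrite ler_nat.
  apply: leq_trans (ltnW (ltn_expl _ (leqnn 2))) _.
  by rewrite leq_exp2l// leq_addl.
have -> : b t - b (fl n) = (b t - b (fl (n + i)%N)) + (b (fl (n + i)%N) - b (fl n)) by ring.
apply: le_trans (ler_normD _ _) _; rewrite addrC; apply: lerD.
  exact: le_trans (sum i) (small i).
apply/ltW/rP; first by rewrite fl0 (le_lt_trans (flle _)).
by rewrite ger0_norm ?subr_ge0//; exact: lt_trans (flgt _) ir.
Qed.

End Chaining.

Section Increments.
Context (R : realType) (dsp : measure_display) (Omega : measurableType dsp).
Variable P : probability Omega R.

(** Gives the summable union bound over about 2^n increments: exp (- v) is at most a constant times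
    v^(- M), and r^M >= 4 turns this into 4^(- n). *)
Lemma expR_geometric_le (r u : R) : 1 < r -> 0 < u ->
  exists K, forall n : nat, 2 ^+ n * expR (- (u * r ^+ n)) <= K / 2 ^+ n.
Proof.
move=> r1 u0.
have r0 : 0 < r by lra.
have lr : 0 < ln r by rewrite ln_gt0.
(* M ln r > 3, so r^M >= 1 + M ln r >= 4. *)
pose M := (Num.Def.truncn (3 / ln r)).+1.
have rM : 4 <= r ^+ M.
  rewrite -{1}(lnK (x := r)) ?posrE// -expRM_natl.
  apply: le_trans (expR_ge1Dx _).
  have := truncnS_gt (3 / ln r); rewrite -/M ltr_pdivrMr//; lra.
have M0 : 0 < M%:R :> R by rewrite ltr0n.
have K0 : 0 <= (M%:R / u) ^+ M :> R by rewrite exprn_ge0// divr_ge0 ?(ltW u0)// ltW.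
exists ((M%:R / u) ^+ M) => n.
have v0 : 0 < u * r ^+ n by rewrite mulr_gt0// exprn_gt0.
(* From x <= exp x at x = u r^n / M. *)
have h : expR (- (u * r ^+ n)) <= (M%:R / (u * r ^+ n)) ^+ M.
  have uE : u * r ^+ n = M%:R * (u * r ^+ n / M%:R) by field; rewrite gt_eqF.
  rewrite expRN {1}uE expRM_natl -exprVn lerXn2r ?nnegrE ?invr_ge0 ?expR_ge0//.
    by rewrite divr_ge0 ?(ltW v0)// ltW.
  rewrite -[leRHS]invf_div lef_pV2 ?posrE ?expR_gt0 ?divr_gt0//.
  by apply: le_trans (expR_ge1Dx _); rewrite lerDr.
have h4 : (r ^+ n) ^+ M >= 4 ^+ n.
  by rewrite -exprM mulnC exprM lerXn2r ?nnegrE ?exprn_ge0 ?(ltW r0).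
have r4 : 0 < 4 ^+ n :> R by rewrite exprn_gt0.
have -> : (M%:R / u) ^+ M / 2 ^+ n = 2 ^+ n * ((M%:R / u) ^+ M / 4 ^+ n).
  have -> : 4 ^+ n = 2 ^+ n * 2 ^+ n :> R by rewrite -exprMn; congr (_ ^+ _); ring.
  by field; rewrite expf_neq0.
apply: ler_wpM2l; first by rewrite exprn_ge0.
apply: le_trans h _; rewrite invfM mulrA exprMn exprVn.
apply: ler_wpM2l => //.
by rewrite lef_pV2 ?posrE// ?exprn_gt0 ?exprn_gt0.
Qed.

Variables (T : R) (B : R -> Omega -> R).
Hypothesis T0 : 0 < T.
Hypothesis mB : forall t, 0 <= t < T -> measurable_fun setT (B t).
Hypothesis lawB : forall s t, 0 <= s -> s < t -> t < T -> forall E : set R,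
  measurable E ->
  P ((fun w => B t w - B s w) @^-1` E) = normal_prob 0 (Num.sqrt (t - s)) E.

(** Borel-Cantelli: a level-n increment has variance T / 2^n, so it exceeds q^n with probability at
    most a constant times exp (- (2 q^2)^n / (4 T)), which remains summable after multiplication by
    the number of increments. *)
Lemma dyadic_increments_ae (q : R) : 0 < q -> 1 < 2 * q ^+ 2 ->
  {ae P, forall w, exists N, forall n k, (N <= n)%N -> (k.+1 < 2 ^ n)%N ->
    `|B (dyadic T n k.+1) w - B (dyadic T n k) w| <= q ^+ n}.
Proof.
move=> q0 q2.
have p2 i : 0 < (2 ^ i)%:R :> R by rewrite ltr0n expn_gt0.
pose C n k := (fun w => B (dyadic T n k.+1) w - B (dyadic T n k) w) @^-1` [set y | q ^+ n < `|y|].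
(* The last dyadic interval is left out because it ends at T, outside the time range. *)
pose D n := \big[setU/set0]_(k < (2 ^ n).-1) C n k.
have m1 (n : nat) : measurable [set y : R | q ^+ n < `|y|].
  rewrite [X in measurable X](_ : _ = (fun y : R => `|y|) @^-1` `]q ^+ n, +oo[).
    by rewrite -[X in measurable X]setTI; exact: (normr_measurable measurableT).
  by apply/seteqP; split => y /=; rewrite in_itv /= andbT.
have dyB n k : (k < 2 ^ n)%N -> 0 <= dyadic T n k < T.
  move=> kn; rewrite /dyadic mulr_ge0 ?divr_ge0 ?(ltW T0)//=.
  by rewrite gtr_pMr// ltr_pdivrMr// mul1r ltr_nat.
have kN n k : (k < (2 ^ n).-1)%N -> (k.+1 < 2 ^ n)%N.
  by move=> ?; rewrite -[X in (_ < X)%N](prednK (expn_gt0 2 n)) ltnS.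
have mC n k : (k < (2 ^ n).-1)%N -> measurable (C n k).
  move=> kn; apply: measurable_preimage => //; apply: measurable_funB; apply: mB; apply: dyB.
    exact: kN.
  exact/ltnW/kN.
have mD n : measurable (D n) by apply: bigsetU_measurable => k _; exact: mC.
have CP n (k : 'I_(2 ^ n).-1) :
    (P (C n k) <= (Num.sqrt 2 * expR (- ((4 * T)^-1 * (2 * q ^+ 2) ^+ n)))%:E)%E.
  have st : dyadic T n k.+1 - dyadic T n k = T / (2 ^ n)%:R.
    by rewrite /dyadic -natr1; field; rewrite gt_eqF.
  have /andP[h1 h2] := dyB _ _ (ltnW (kN n k (ltn_ord k))).
  have /andP[h3 h4] := dyB _ _ (kN n k (ltn_ord k)).
  rewrite /C lawB//; last by rewrite -subr_gt0 st divr_gt0.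
  apply: le_trans (normal_prob_tail_le _ _) _.
  - by rewrite sqrtr_gt0 st divr_gt0.
  - by rewrite exprn_ge0 ?ltW.
  rewrite sqr_sqrtr st; last by rewrite divr_ge0 ?ltW.
  rewrite le_eqVlt; apply/orP; left; apply/eqP; congr ((_ * expR (- _))%:E).
  by rewrite exprMn -exprM mulnC exprM natrX; field; rewrite gt_eqF//= expf_neq0.
have u0 : 0 < (4 * T)^-1 by rewrite invr_gt0 mulr_gt0.
have [K KP] := expR_geometric_le q2 u0.
have K0 : 0 <= K.
  by have := KP 0%N; rewrite !expr0 mul1r divr1 mulr1; apply: le_trans; exact: expR_ge0.
(* The factor 2 brings the bound to the form K' / 2^(n + 1), whose series [epsilon_trick0] sums. *)
pose K' := 2 * (Num.sqrt 2 * K).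
have K'0 : 0 <= K' by rewrite !mulr_ge0.
have DP n : (P (D n) <= (K' / (2 ^ n.+1)%:R)%:E)%E.
  apply: le_trans (Boole_inequality P (mC n)) _.
  apply: (@le_trans _ _ (\sum_(k < (2 ^ n).-1) (Num.sqrt 2 * expR (- ((4 * T)^-1 * (2 * q ^+ 2) ^+ n)))%:E)%E).
    by apply: lee_sum => k _; exact: CP.
  rewrite sumEFin lee_fin sumr_const card_ord -[leLHS]mulr_natr.
  have := KP n => KPn.
  have h : ((2 ^ n).-1)%:R <= 2 ^+ n :> R by rewrite -natrX ler_nat leq_pred.
  have s2 : 0 <= Num.sqrt 2 :> R by rewrite sqrtr_ge0.
  have -> : K' / (2 ^ n.+1)%:R = Num.sqrt 2 * (K / 2 ^+ n).
    by rewrite /K' natrX exprS; field; rewrite expf_neq0.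
  rewrite -[leLHS]mulrA; apply: ler_wpM2l => //; apply: le_trans KPn; rewrite mulrC.
  by apply: ler_wpM2r h; exact: expR_ge0.
have lim0 : P (lim_sup_set D) = 0%E.
  apply: lim_sup_set_cvg0 => //.
  apply: le_lt_trans (lee_nneseries _ _) (le_lt_trans (epsilon_trick0 xpredT K'0) (ltry _)).
  - by move=> n *; exact: measure_ge0.
  - by move=> n *; exact: DP.
exists (lim_sup_set D); split => //.
  apply: bigcap_measurableType => n _; exact: bigcup_measurable.
move=> w /= Hw n _.
apply: contrapT => nD; apply: Hw; exists n => i k ni ki.
rewrite leNgt; apply/negP => bad; apply: nD; exists i => //.
have ki' : (k < (2 ^ i).-1)%N by rewrite -ltnS (prednK (expn_gt0 2 i)).
by rewrite /D -bigcup_mkord; exists k.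
Qed.

Lemma terminal_holder_ae (kap : R) : kap < 1 / 2 -> 0 < kap ->
  {ae P, forall w, {within `[0, T[, continuous (fun t => B t w)}} ->
  {ae P, forall w, exists l C s0, forall s, s0 <= s ->
    `|B (T - T * expR (- s)) w - l| <= C * expR (- kap * s)}.
Proof.
move=> k12 k0 cB.
pose l2 : R := ln 2.
have l20 : 0 < l2 by rewrite ln_gt0//; lra.
(* q = 2^(- kap), so 2 q^2 = 2^(1 - 2 kap) > 1 is exactly kap < 1 / 2. *)
pose q := expR (- (kap * l2)).
have q0 : 0 < q by exact: expR_gt0.
have q1 : q < 1 by rewrite expR_lt1 oppr_lt0 mulr_gt0.
have q2 : 1 < 2 * q ^+ 2.
  rewrite -[X in X * _](lnK (x := 2)) ?posrE// -expRM_natl -expRD expR_gt1 -/l2.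
  have -> : l2 + 2%:R * - (kap * l2) = l2 * (1 - 2 * kap) by ring.
  by rewrite mulr_gt0//; lra.
have := dyadic_increments_ae q0 q2.
apply: filterS2 cB => w cB [N NP].
(* With n the integer part of s / ln 2, two later values are both compared with the one at T (1 -
   2^(- n)), hence the 2; the exponential pays for rounding in q^n <= e^(kap ln 2) e^(- kap s). *)
pose C := 2 / (1 - q) * expR (kap * l2).
pose s0 := N%:R * l2.
have [l lP] : exists l, forall s, s0 <= s ->
    `|B (T - T * expR (- s)) w - l| <= C * expR (- kap * s).
  apply: (@cauchy_rate _ (fun s => B (T - T * expR (- s)) w)) => s t s0s st.
  have s_0 : 0 <= s by apply: le_trans s0s; rewrite mulr_ge0// ltW.
  pose n := Num.Def.truncn (s / l2).
  have /andP[n1 n2] : n%:R <= s / l2 < n.+1%:R by apply: truncn_itv; rewrite divr_ge0// ltW.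
  rewrite ler_pdivlMr// in n1; rewrite ltr_pdivrMr// in n2.
  have Nn : (N <= n)%N by rewrite truncn_ge_nat ?divr_ge0// ?ler_pdivlMr// ltW.
  have en : expR (- s) <= ((2 ^ n)%:R)^-1.
    rewrite expRN lef_pV2 ?posrE ?expR_gt0 ?ltr0n ?expn_gt0//.
    rewrite natrX -[X in X ^+ _](lnK (x := 2)) ?posrE// -expRM_natl ler_expR -/l2; lra.
  have range u : expR (- u) <= ((2 ^ n)%:R)^-1 ->
      T * (1 - ((2 ^ n)%:R)^-1) <= T - T * expR (- u) < T.
    move=> ue; have -> : T - T * expR (- u) = T * (1 - expR (- u)) by ring.
    by rewrite ler_pM2l// lerB//= gtr_pMr// gtrBl expR_gt0.
  have est : expR (- t) <= expR (- s) by rewrite ler_expR lerN2.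
  have q01 : 0 < q < 1 by rewrite q0.
  have h1 := dyadic_chaining T0 q01 cB NP Nn (range s en).
  have h2 := dyadic_chaining T0 q01 cB NP Nn (range t (le_trans est en)).
  have q1' : 0 < 1 - q by rewrite subr_gt0.
  apply: (@le_trans _ _ (2 * (q ^+ n / (1 - q)))).
    set y := B (T * _) w in h1 h2.
    have -> : B (T - T * expR (- t)) w - B (T - T * expR (- s)) w =
      (B (T - T * expR (- t)) w - y) - (B (T - T * expR (- s)) w - y) by ring.
    by apply: le_trans (ler_normB _ _) _; lra.
  rewrite /C; have -> : 2 * (q ^+ n / (1 - q)) = 2 / (1 - q) * q ^+ n by ring.
  rewrite -!mulrA; apply: ler_wpM2l => //; apply: ler_wpM2l; first by rewrite invr_ge0 ltW.
  rewrite -expRM_natl -expRD ler_expR.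
  rewrite -natr1 in n2.
  have : kap * s <= kap * ((n%:R + 1) * l2) by rewrite ler_pM2l// ltW.
  lra.
by exists l, C, s0.
Qed.

End Increments.

(** * Time change *)

Section Clock.
Context (R : realType).

(** The time t in [0, T) with ln (T / (T - t)) = s, for s >= 0. *)
Definition clock (T s : R) : R := T - T * expR (- s).

Lemma clock_itv (T s : R) : 0 < T -> 0 <= s -> 0 <= clock T s < T.
Proof.
move=> T0 s0; have -> : clock T s = T * (1 - expR (- s)) by rewrite /clock; ring.
rewrite pmulr_rge0// subr_ge0 expR_le1 oppr_le0 s0 /=.
by rewrite gtr_pMr// gtrBl expR_gt0.
Qed.

Lemma clock0 (T : R) : clock T 0 = 0.
Proof. by rewrite /clock oppr0 expR0 mulr1 subrr. Qed.

Lemma clock_incr (T s t : R) : 0 < T -> s < t -> clock T s < clock T t.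
Proof. by move=> T0 st; rewrite /clock ltrD2l ltrN2 ltr_pM2l// ltr_expR ltrN2. Qed.

(** In this form the derivative cancels the singular factor 1 / (T - t) of the drift. *)
Lemma is_derive_clock (T s : R) : is_derive s 1 (clock T) (T - clock T s).
Proof.
have H := is_deriveB (is_derive_cst (T : R) (s : R) (1 : R)) (is_deriveZ T (is_derive_expM (-1) s)).
have E : clock T = (cst T - T \*: (fun t => expR (-1 * t))).
  by apply/funext => t; rewrite /clock -[- t]mulN1r.
rewrite E; apply: is_derive_eq H _; rewrite -E.
by rewrite /clock /GRing.scale /= -[- s]mulN1r; ring.
Qed.

Lemma continuous_clock (T : R) : continuous (clock T).
Proof.
move=> t; apply: differentiable_continuous; apply/derivable1_diffP.
by have [] := is_derive_clock T t.
Qed.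

(* A path on [0, T) seen in the time scale s = ln (T / (T - t)); it is frozen at
   negative times so as to be continuous on the whole line. *)
Definition time_changed (T : R) (b : R -> R) (s : R) := b (clock T (Num.max 0 s)).

Lemma time_changedE (T s : R) (b : R -> R) : 0 <= s -> time_changed T b s = b (clock T s).
Proof. by move=> s0; rewrite /time_changed max_r. Qed.

Lemma continuous_time_changed (T : R) (b : R -> R) : 0 < T ->
  {within `[0, T[, continuous b} -> continuous (time_changed T b).
Proof.
move=> T0 cb s; apply/cvgrPdist_lt => e e0.
have m0 r : 0 <= Num.max 0 r :> R by rewrite le_max lexx.
have [r r0 rP] := within_continuous_dist cb (clock_itv T0 (m0 s)) e0.
have : {for s, continuous (fun s : R => clock T (Num.max 0 s))}.
  apply: (@continuous_comp R R R (fun s => Num.max 0 s) (clock T)); last exact: continuous_clock.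
  by apply: (@continuous_max R R (cst 0) id); [exact: cvg_cst|exact: cvg_id].
move=> /cvgrPdist_lt /(_ _ r0); apply: filterS => t.
by apply: rP; exact: clock_itv.
Qed.

Lemma near_clockP (T : R) (A : R -> Prop) : 0 < T ->
  (\forall t \near T^'-, A t) <-> exists s0, forall s, s0 <= s -> A (clock T s).
Proof.
move=> T0; split.
  rewrite near_withinE => /nbhs_ballP[r /= r0 rP].
  exists (ln (T / r) + 1) => s hs.
  have sE : expR (- s) < r / T.
    rewrite -[r / T]lnK ?posrE ?divr_gt0// ltr_expR -[r / T]invf_div lnV ?posrE ?divr_gt0//.
    by rewrite ltrN2; lra.
  have Ts : T - clock T s = T * expR (- s) by rewrite /clock; ring.
  have Ts0 : 0 < T * expR (- s) by rewrite mulr_gt0 ?expR_gt0.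
  apply: rP; last by rewrite -subr_gt0 Ts.
  by rewrite /ball /= Ts gtr0_norm// mulrC -ltr_pdivlMr.
move=> [s0 sA]; near=> t.
have tT : 0 < T - t by rewrite subr_gt0; near: t; exact: nbhs_left_lt.
have h : clock T s0 <= t.
  near: t; apply: nbhs_left_ge; rewrite -subr_gt0 /clock.
  by have -> : T - (T - T * expR (- s0)) = T * expR (- s0); [ring|rewrite mulr_gt0 ?expR_gt0].
have Tt0 : 0 < (T - t) / T by rewrite divr_gt0.
have -> : t = clock T (- ln ((T - t) / T)).
  by rewrite /clock opprK lnK ?posrE//; field; rewrite gt_eqF.
apply: sA; rewrite lerNr -[- s0]expRK ler_ln ?posrE ?expR_gt0// ler_pdivrMr//.
by move: h; rewrite /clock; lra.
Unshelve. all: by end_near. Qed.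

End Clock.

Section Drift.
Context (R : realType).

Lemma within_continuous_coord (D : set R) m n (M : R -> 'M[R]_(m, n)) i j :
  {within D, continuous M} -> {within D, continuous (fun t => M t i j)}.
Proof.
move=> /subspace_continuousP cM; apply/subspace_continuousP => x Dx.
apply: (@cvg_comp _ _ _ M (fun N : 'M[R]_(m, n) => N i j)); first exact: cM.
exact: coord_continuous.
Qed.

Lemma within_continuous_mulmx (D : set R) m n p (N : 'M[R]_(m, n)) (M : R -> 'M[R]_(n, p)) i j :
  {within D, continuous M} -> {within D, continuous (fun t => (N *m M t) i j)}.
Proof.
move=> cM.
have -> : (fun t => (N *m M t) i j) = (fun t => \sum_k N i k * M t k j).
  by apply/funext => t; rewrite mxE.
apply/subspace_continuousP => x Dx.
apply: (cvg_big (op := +%R) (@add_continuous R)) => k _; apply: cvgM; first exact: cvg_cst.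
by have /subspace_continuousP := within_continuous_coord (i := k) (j := j) cM; exact.
Qed.

Lemma continuous_at_of_within (T x : R) (g : R -> R) :
  {within `[0, T[, continuous g} -> 0 < x < T -> {for x, continuous g}.
Proof.
move=> cg /andP[x0 xT]; apply/cvgrPdist_lt => e e0.
have xI : 0 <= x < T by rewrite (ltW x0).
have [r r0 rP] := within_continuous_dist cg xI e0.
apply/nbhs_ballP; exists (Num.min r (Num.min x (T - x))) => /=.
  by rewrite !lt_min r0 x0 subr_gt0.
move=> y; rewrite /ball /= !lt_min => /andP[xyr /andP[xyx xyT]]; apply: rP => //.
by move: xyx xyT; rewrite !ltr_distlC; lra.
Qed.

Lemma derive_integral (T t : R) (g : R -> R) :
  {within `[0, T[, continuous g} -> 0 < t < T ->
  is_derive t 1 (fun t => \int[lebesgue_measure]_(s in `[0, t]) g s) (g t).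
Proof.
move=> cg tT; have /andP[t0 tT'] := tT.
(* The integrand may be unbounded near T, so the fundamental theorem is applied on [0, u] with t < u
   < T. *)
pose u := (t + T) / 2.
have tu : t < u by rewrite /u; lra.
have gi : (@lebesgue_measure R).-integrable `[0, u] (EFin \o g).
  apply: continuous_compact_integrable; first exact: segment_compact.
  apply: continuous_subspaceW cg => s /=; rewrite !in_itv /= => /andP[-> su] /=.
  by apply: le_lt_trans su _; rewrite /u; lra.
have [d1 d2] := continuous_FTC1_closed tu gi t0 (continuous_at_of_within cg tT).
by rewrite -d2 derive1E; exact: derivableP.
Qed.

Definition row_path (T : R) (n : nat) (X : R -> 'cV[R]_n) (u : 'rV[R]_n) : R -> R :=
  time_changed T (fun t => (u *m X t) 0 0).

Lemma continuous_row_path (T : R) (n : nat) (X : R -> 'cV[R]_n) (u : 'rV[R]_n) :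
  0 < T -> {within `[0, T[, continuous X} -> continuous (row_path T X u).
Proof.
by move=> T0 cX; apply: continuous_time_changed => //; exact: within_continuous_mulmx.
Qed.

(** Subtracting the noise leaves the drift integral, which is differentiable path by path; after the
    change of time its derivative has no singular factor. *)
Lemma row_path_derive (T : R) (n m : nat) (A : 'M[R]_n) (Sigma : 'M[R]_(n, m))
    (X : R -> 'cV[R]_n) (b : R -> 'cV[R]_m) (u : 'rV[R]_n) (s : R) :
  0 < T -> {within `[0, T[, continuous X} ->
  (forall t, 0 <= t < T -> X t =
     (\col_i \int[lebesgue_measure]_(r in `[0, t]) (- (T - r)^-1 * (A *m X r) i 0))
     + Sigma *m (b t - b 0)) ->
  0 < s ->
  is_derive s 1
    (fun r => row_path T X u r - row_path T (fun t => b t - b 0) (u *m Sigma) r)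
    (- row_path T X (u *m A) s).
Proof.
move=> T0 cX eqX s0.
pose g (i : 'I_n) (r : R) : R := - (T - r)^-1 * (A *m X r) i 0.
pose I (i : 'I_n) (t : R) : R := \int[lebesgue_measure]_(r in `[0, t]) g i r.
have cg i : {within `[0, T[, continuous (g i)}.
  have /subspace_continuousP cAX := within_continuous_mulmx (i := i) (j := 0) (N := A) cX.
  apply/subspace_continuousP => t /[dup] tI; rewrite /= in_itv /= => /andP[_ tT].
  apply: cvgM; last exact: cAX.
  apply: cvgN; apply: cvg_within_filter; apply: cvgV; first by rewrite subr_eq0 gt_eqF.
  by apply: cvgB; [exact: cvg_cst|exact: cvg_id].
pose t := clock T s.
have tI : 0 < t < T.
  by have /andP[_ ->] := clock_itv T0 (ltW s0); rewrite -(clock0 T) clock_incr.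
pose J r := \sum_i u 0 i * I i r.
have dJ : is_derive t 1 J (\sum_i u 0 i * g i t).
  have H := is_derive_sum (fun i : 'I_n => is_deriveZ (u 0 i) (derive_integral (cg i) tI)).
  have E : J = \sum_i (u 0 i \*: I i).
    by apply/funext => r; rewrite fct_sumE.
  by rewrite E.
have dJs := is_derive1_comp dJ (is_derive_clock T s).
have E : - row_path T X (u *m A) s = (\sum_i u 0 i * g i t) * (T - clock T s).
  rewrite /row_path time_changedE ?(ltW s0)// -/t -mulmxA mxE mulr_suml -sumrN.
  apply: eq_bigr => i _; rewrite /g; field.
  by rewrite gt_eqF// subr_gt0; case/andP: tI.
rewrite E; apply: near_eq_is_derive dJs.
(* The ball of radius s about s stays in positive times, where the path is not frozen. *)
apply/nbhs_ballP; exists s => //= r; rewrite /ball /= ltr_distlC => /andP[r0 _].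
have {}r0 : 0 <= r by lra.
rewrite /row_path !time_changedE// -/(J _) (eqX _ (clock_itv T0 r0)) mulmxDr mulmxA.
rewrite [X in _ = X - _]mxE addrK mxE.
by apply: eq_bigr => i _; rewrite mxE.
Qed.

End Drift.

(** * Decay along generalized complex eigenrows *)

Section ComplexRows.
Context (R : rcfType).
Local Notation C := (complex R).
Local Notation toC := (real_complex R).
Local Notation reC := (@complex.Re R).
Local Notation imC := (@complex.Im R).

Lemma Re_sum (I : finType) (F : I -> C) : reC (\sum_i F i) = \sum_i reC (F i).
Proof. by apply: (big_morph reC) => // -[? ?] [? ?]. Qed.

Lemma Im_sum (I : finType) (F : I -> C) : imC (\sum_i F i) = \sum_i imC (F i).
Proof. by apply: (big_morph imC) => // -[? ?] [? ?]. Qed.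

Lemma Re_mulmx_real m n p (M : 'M[C]_(m, n)) (N : 'M[R]_(n, p)) :
  map_mx reC (M *m map_mx toC N) = map_mx reC M *m N.
Proof.
apply/matrixP => i j; rewrite !mxE Re_sum; apply: eq_bigr => k _.
by rewrite !mxE; case: (M i k) => u v /=; ring.
Qed.

Lemma Im_mulmx_real m n p (M : 'M[C]_(m, n)) (N : 'M[R]_(n, p)) :
  map_mx imC (M *m map_mx toC N) = map_mx imC M *m N.
Proof.
apply/matrixP => i j; rewrite !mxE Im_sum; apply: eq_bigr => k _.
by rewrite !mxE; case: (M i k) => u v /=; ring.
Qed.

(** With its imaginary counterpart, it turns one step of a complex Jordan chain into the coupled
    real equations treated by [rotation_ode_decay]. *)
Lemma Re_row_mul n (A : 'M[R]_n) (l : C) (c c' : 'rV[C]_n) :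
  c *m map_mx toC A = l *: c + c' ->
  map_mx reC c *m A = reC l *: map_mx reC c - imC l *: map_mx imC c + map_mx reC c'.
Proof.
move=> cA; rewrite -Re_mulmx_real cA; apply/matrixP => i j; rewrite !mxE.
by case: l {cA} => a b; case: (c i j) => u v; case: (c' i j) => x y.
Qed.

Lemma Im_row_mul n (A : 'M[R]_n) (l : C) (c c' : 'rV[C]_n) :
  c *m map_mx toC A = l *: c + c' ->
  map_mx imC c *m A = reC l *: map_mx imC c + imC l *: map_mx reC c + map_mx imC c'.
Proof.
move=> cA; rewrite -Im_mulmx_real cA; apply/matrixP => i j; rewrite !mxE.
by case: l {cA} => a b; case: (c i j) => u v; case: (c' i j) => x y.
Qed.

End ComplexRows.

Section Decay.
Context (R : realType) (T : R) (n m : nat).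
Variables (A : 'M[R]_n.+1) (Sigma : 'M[R]_(n.+1, m)).
Variables (X : R -> 'cV[R]_n.+1) (b : R -> 'cV[R]_m).
Local Notation C := (complex R).
Local Notation toC := (real_complex R).
Local Notation reC := (@complex.Re R).
Local Notation imC := (@complex.Im R).

Lemma row_pathD p (Y : R -> 'cV[R]_p) (u v : 'rV[R]_p) s :
  row_path T Y (u + v) s = row_path T Y u s + row_path T Y v s.
Proof. by rewrite /row_path /time_changed mulmxDl mxE. Qed.

Lemma row_pathZ p (Y : R -> 'cV[R]_p) (k : R) (u : 'rV[R]_p) s :
  row_path T Y (k *: u) s = k * row_path T Y u s.
Proof. by rewrite /row_path /time_changed -scalemxAl mxE. Qed.

Lemma row_pathN p (Y : R -> 'cV[R]_p) (u : 'rV[R]_p) s :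
  row_path T Y (- u) s = - row_path T Y u s.
Proof. by rewrite /row_path /time_changed mulNmx mxE. Qed.

(** Holder regularity of order kap of the noise at T, since e^(- kap s) = ((T - t) / T)^kap. *)
Definition terminal_rate (kap : R) :=
  forall r : 'rV[R]_m, exists l K s0, forall s, s0 <= s ->
    `|row_path T (fun t => b t - b 0) r s - l| <= K * expR (- kap * s).

Hypothesis T0 : 0 < T.
Hypothesis cX : {within `[0, T[, continuous X}.
Hypothesis cb : {within `[0, T[, continuous b}.
Hypothesis eqX : forall t, 0 <= t < T -> X t =
  (\col_i \int[lebesgue_measure]_(r in `[0, t]) (- (T - r)^-1 * (A *m X r) i 0))
  + Sigma *m (b t - b 0).

Lemma continuous_noise (r : 'rV[R]_m) :
  continuous (row_path T (fun t => b t - b 0) r).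
Proof.
apply: continuous_row_path => //.
move: cb => /subspace_continuousP cb'; apply/subspace_continuousP => t tI.
by apply: cvgB; [exact: cb'|exact: cvg_cst].
Qed.

Lemma continuous_drift (u : 'rV[R]_n.+1) :
  continuous (fun s => row_path T X u s - row_path T (fun t => b t - b 0) (u *m Sigma) s).
Proof.
by move=> s; apply: cvgB; [exact: continuous_row_path|exact: continuous_noise].
Qed.

Lemma generalized_eigenrow_decay (kap a : R) (ls : seq C) (c : 'rV[C]_n.+1) :
  kap < a -> terminal_rate kap -> (forall l, l \in ls -> reC l = a) ->
  c *m horner_mx (map_mx toC A) (\prod_(l <- ls) ('X - l%:P)) = 0 ->
  exists K s0, forall s, s0 <= s ->
    `|row_path T X (map_mx reC c) s| <= K * expR (- kap * s) /\
    `|row_path T X (map_mx imC c) s| <= K * expR (- kap * s).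
Proof.
move=> ka rate; elim: ls c => [|l ls IH] c la.
  rewrite big_nil rmorph1 mulmx1 => ->; exists 0, 0 => s _.
  have z (f : C -> R) : f 0 = 0 -> map_mx f (0 : 'rV[C]_n.+1) = 0.
    by move=> f0; apply/matrixP => i j; rewrite !mxE f0.
  rewrite !z//.
  have -> : row_path T X 0 s = 0 by rewrite /row_path /time_changed mul0mx mxE.
  by rewrite normr0 mul0r.
rewrite big_cons rmorphM rmorphB /= horner_mx_X horner_mx_C mulmxA.
(* The row [c'] = c (A - l) is killed by the remaining factors, so the induction hypothesis bounds
   it; it is the forcing term in the equation for [c]. *)
set c' := c *m _ => c'0.
have [Kg [sg gP]] := IH c' (fun z zl => la z (mem_behead (s := l :: ls) zl)) c'0.
have cA : c *m map_mx toC A = l *: c + c'.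
  by rewrite /c' mulmxBr mul_mx_scalar addrC subrK.
have la' : reC l = a by apply: la; rewrite mem_head.
have reA := Re_row_mul cA; have imA := Im_row_mul cA.
rewrite la' in reA imA.
set u1 := map_mx reC c in reA imA *; set u2 := map_mx imC c in reA imA *.
have [l1 [K1 [s1 r1]]] := rate (u1 *m Sigma).
have [l2 [K2 [s2 r2]]] := rate (u2 *m Sigma).
pose K := Num.max Kg (Num.max K1 K2).
pose s0 := Num.max 0 (Num.max sg (Num.max s1 s2)).
have KK x : x <= K -> forall s, x * expR (- kap * s) <= K * expR (- kap * s).
  by move=> xK s; rewrite ler_wpM2r// expR_ge0.
have s00 : 0 <= s0 by rewrite le_max lexx.
pose f u s := row_path T X u s - row_path T (fun t => b t - b 0) (u *m Sigma) s.
have df u s : s0 < s -> is_derive s 1 (f u) (- row_path T X (u *m A) s).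
  by move=> s0s; apply: row_path_derive => //; exact: le_lt_trans s0s.
have ss s : s0 < s -> [/\ sg <= s, s1 <= s & s2 <= s].
  by move/ltW; rewrite !ge_max => /and4P[].
have cf u : continuous (f u) by exact: continuous_drift.
apply: (@rotation_ode_decay R a (imC l) kap K s0 l1 l2 (f u1) (f u2) _ _
  (row_path T X (map_mx reC c')) (row_path T X (map_mx imC c'))) => //.
- by move=> s /(df u1); rewrite reA !row_pathD row_pathN !row_pathZ.
- by move=> s /(df u2); rewrite imA !row_pathD !row_pathZ.
- move=> s /ss[_ h1 _]; rewrite /f opprB addrCA subrr addr0.
  by apply: le_trans (r1 s h1) (KK _ _ s); rewrite !le_max lexx orbT.
- move=> s /ss[_ _ h2]; rewrite /f opprB addrCA subrr addr0.
  by apply: le_trans (r2 s h2) (KK _ _ s); rewrite !le_max lexx !orbT.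
- move=> s /ss[h _ _]; have [h1 _] := gP s h.
  by apply: le_trans h1 (KK _ _ s); rewrite !le_max lexx.
- move=> s /ss[h _ _]; have [_ h2] := gP s h.
  by apply: le_trans h2 (KK _ _ s); rewrite !le_max lexx.
Qed.

End Decay.

(** * Weighted sums of Wiener increments *)

Section Wiener.
Context (R : realType) (dsp : measure_display) (Omega : measurableType dsp).
Variables (P : probability Omega R) (T : R) (m : nat) (B : R -> Omega -> 'cV[R]_m).
Hypothesis T0 : 0 < T.
Hypothesis hB : standard_wiener P T B.

Let mB t i : 0 <= t < T -> measurable_fun setT (fun w => B t w i 0).
Proof. by move=> tT; case: hB => h _ _ _ _; exact: h. Qed.

Let lawB i s t : 0 <= s -> s < t -> t < T -> forall E : set R, measurable E ->
  P ((fun w => B t w i 0 - B s w i 0) @^-1` E) = normal_prob 0 (Num.sqrt (t - s)) E.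
Proof. by move=> s0 st tT E mE; case: hB => _ _ _ h _; exact: h. Qed.

Lemma measurable_row_increments n (t : nat -> R) (c : 'I_n -> 'rV[R]_m) :
  (forall k, (k <= n)%N -> 0 <= t k < T) ->
  measurable_fun setT (fun w => \sum_(k < n) (c k *m (B (t k.+1) w - B (t k) w)) 0 0).
Proof.
move=> tT; apply: measurable_sum => k.
have -> : (fun w => (c k *m (B (t k.+1) w - B (t k) w)) 0 0) =
  (fun w => \sum_i c k 0 i * (B (t k.+1) w i 0 - B (t k) w i 0)).
  by apply/funext => w; rewrite mxE; apply: eq_bigr => i _; rewrite !mxE.
apply: measurable_sum => i; apply: measurable_funM => //.
by apply: measurable_funB; apply: mB; apply: tT => //; exact: ltnW.
Qed.

Definition small_increments n (t : nat -> R) (c : 'I_n -> 'rV[R]_m) (e : R) :=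
  [set w | `|\sum_(k < n) (c k *m (B (t k.+1) w - B (t k) w)) 0 0| <= e].

Lemma measurable_small_increments n (t : nat -> R) (c : 'I_n -> 'rV[R]_m) (e : R) :
  (forall k, (k <= n)%N -> 0 <= t k < T) -> measurable (small_increments t c e).
Proof.
move=> tT.
have mS : measurable_fun setT (fun w => `|\sum_(k < n) (c k *m (B (t k.+1) w - B (t k) w)) 0 0|).
  by apply: measurableT_comp => //; exact: measurable_row_increments.
rewrite [X in measurable X](_ : _ = (fun w => `|\sum_(k < n) (c k *m (B (t k.+1) w - B (t k) w)) 0 0|) @^-1` `]-oo, e]).
  exact: measurable_preimage.
by apply/seteqP; split => w /=; rewrite in_itv.
Qed.

(** Anticoncentration over the scalar increments indexed by pairs (k, i): the one at (k0, i0) is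
    Gaussian with density at most the inverse of its standard deviation. *)
Lemma small_increments_le n (t : nat -> R) (c : 'I_n -> 'rV[R]_m) (k0 : 'I_n) (i0 : 'I_m) (e : R) :
  (forall k, (k <= n)%N -> 0 <= t k < T) ->
  (forall k, (k < n)%N -> t k < t k.+1) -> c k0 0 i0 != 0 -> 0 < e ->
  (P (small_increments t c e) <= (4 * e / (Num.sqrt (t k0.+1 - t k0) * `|c k0 0 i0|))%:E)%E.
Proof.
move=> tT tincr c0 e0.
have kn (k : 'I_n) : (k.+1 <= n)%N by exact: ltn_ord.
pose Y (ki : 'I_n * 'I_m) w := B (t ki.1.+1) w ki.2 0 - B (t ki.1) w ki.2 0.
have mY ki : measurable_fun setT (Y ki).
  by apply: measurable_funB; apply: mB; apply: tT => //; exact: ltnW.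
have iY : mutually_independent P Y.
  by case: hB => _ _ _ _ h; exact: (h n t tT tincr).
have sg0 : 0 < Num.sqrt (t k0.+1 - t k0) by rewrite sqrtr_gt0 subr_gt0 tincr.
have YL x y : x <= y -> (P (Y (k0, i0) @^-1` `[x, y]) <= ((Num.sqrt (t k0.+1 - t k0))^-1 * (y - x))%:E)%E.
  move=> xy; rewrite mulrC /Y /= lawB//.
  - exact: normal_prob_itv_le.
  - by have /andP[] := tT k0 (ltnW (kn k0)).
  - exact: tincr.
  - by have /andP[] := tT k0.+1 (kn k0).
have := anticoncentration (c := fun ki => c ki.1 0 ki.2) mY iY YL c0 e0.
have <- : 4 * (Num.sqrt (t k0.+1 - t k0))^-1 * e / `|c k0 0 i0| = 4 * e / (Num.sqrt (t k0.+1 - t k0) * `|c k0 0 i0|).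
  by field; rewrite normr_eq0 c0 gt_eqF.
apply: le_trans; rewrite le_eqVlt; apply/orP; left; apply/eqP; congr (P _).
apply/seteqP; split => w /=; rewrite -(pair_bigA _ (fun k i => c k 0 i * Y (k, i) w)) /=;
  congr (`|_| <= e); apply: eq_bigr => k _; rewrite mxE; apply: eq_bigr => i _; rewrite !mxE//.
Qed.

Lemma terminal_rate_ae (kap : R) : 0 < kap -> kap < 1 / 2 ->
  {ae P, forall w, terminal_rate T (fun t => B t w) kap}.
Proof.
move=> k0 k12.
have cBi i : {ae P, forall w, {within `[0, T[, continuous (fun t => B t w i 0)}}.
  case: hB => _ _ h _ _; apply: filterS h => w; exact: within_continuous_coord.
have H i := terminal_holder_ae T0 (fun t => @mB t i) (@lawB i) k12 k0 (cBi i).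
have {}H : \forall w \ae P, forall i : 'I_m, exists l C s0, forall s, s0 <= s ->
    `|B (T - T * expR (- s)) w i 0 - l| <= C * expR (- kap * s).
  by apply: filter_forall => i; exact: H.
apply: filterS H => w /choice[l /choice[C /choice[s0 sP]]] r.
exists (\sum_i r 0 i * (l i - B 0 w i 0)), (\sum_i `|r 0 i| * C i), (\sum_i `|s0 i|) => s hs.
have si i : s0 i <= s.
  apply: le_trans hs; apply: le_trans (ler_norm _) _.
  by rewrite (bigD1 i)//= lerDl sumr_ge0.
have s_0 : 0 <= s by apply: le_trans hs; exact: sumr_ge0.
rewrite /row_path time_changedE// mxE -sumrB mulr_suml.
apply: le_trans (ler_norm_sum _ _ _) _; apply: ler_sum => i _.
rewrite !mxE -mulrBr opprB addrA addrNK normrM -mulrA; apply: ler_wpM2l => //.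
exact: sP.
Qed.

End Wiener.

(** * Eigenrows *)

Section Eigenrow.
Context (R : realType) (dsp : measure_display) (Omega : measurableType dsp).
Variables (P : probability Omega R) (T : R) (n m : nat).
Variables (A : 'M[R]_n.+1) (Sigma : 'M[R]_(n.+1, m)).
Variables (B : R -> Omega -> 'cV[R]_m) (X : R -> Omega -> 'cV[R]_n.+1).
Hypothesis T0 : 0 < T.
Hypothesis hB : standard_wiener P T B.
Hypothesis hX : strong_solution P T A Sigma B X.

Lemma solution_path_ae : {ae P, forall w,
  [/\ {within `[0, T[, continuous (fun t => X t w)},
      {within `[0, T[, continuous (fun t => B t w)},
      X 0 w = 0
    & forall t, 0 <= t < T -> X t w =
       (\col_i \int[lebesgue_measure]_(r in `[0, t]) (- (T - r)^-1 * (A *m X r w) i 0))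
       + Sigma *m (B t w - B 0 w)]}.
Proof.
case: hB => _ _ cB _ _; case: hX => _ cX X0 eqX.
by apply: filterS (filterI (filterI cX cB) (filterI X0 eqX)) => w [[? ?] [? ?]].
Qed.

Variables (a be : R) (u1 u2 : 'rV[R]_n.+1) (i0 : 'I_m).
Hypothesis u1A : u1 *m A = a *: u1 - be *: u2.
Hypothesis u2A : u2 *m A = a *: u2 + be *: u1.
Hypothesis v0 : (u1 *m Sigma) 0 i0 != 0.
Let v := u1 *m Sigma.

Let unit_step (N j : nat) : R := clock T (N + j)%:R.

Let unit_stepT N k : 0 <= unit_step N k < T.
Proof. exact: clock_itv. Qed.

Let unit_step_incr N k : unit_step N k < unit_step N k.+1.
Proof. by apply: clock_incr => //; rewrite ltr_nat addnS. Qed.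

(** The random constant of a pathwise bound is replaced by the integers [k.+1], so that countably
    many events suffice. *)
Let slow (eps : R) (k N : nat) :=
  small_increments B (n := 1) (unit_step N) (fun=> v) (k.+1%:R * expR (- (1 / 2 + eps) * N%:R)).

Let measurable_slow eps k N : measurable (slow eps k N).
Proof. by apply: (measurable_small_increments hB) => j _; exact: unit_stepT. Qed.

(** The scalar increments over the N-th unit step have standard deviation D e^(- N / 2), so
    [slow eps k N] has probability at most a constant times e^(- eps N). *)
Let negligible_slow eps k : 0 < eps -> P.-negligible (set_liminf (slow eps k)).
Proof.
move=> eps0; apply: negligible_approx => c c0.
exists (set_liminf (slow eps k)); split => //; first exact: measurable_set_liminf.
have e1 : 0 < 1 - expR (-1) :> R by rewrite subr_gt0 expR_lt1 ltrN10.
pose D := Num.sqrt (T * (1 - expR (-1))).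
have D0 : 0 < D by rewrite sqrtr_gt0 mulr_gt0.
have nv0 : 0 < `|v 0 i0| by rewrite normr_gt0.
have [s0 s0P] := expR_small (4 * k.+1%:R / (D * `|v 0 i0|)) c0.
apply: (@set_liminf_le _ _ _ _ _ _ (Num.Def.truncn (s0 / eps)).+1) => // N NN.
have eN0 : 0 < k.+1%:R * expR (- (1 / 2 + eps) * N%:R) :> R by rewrite mulr_gt0 ?expR_gt0.
apply: le_trans (small_increments_le hB (t := unit_step N) (c := fun=> v) (k0 := ord0) (i0 := i0) _ _ _ eN0) _ => //.
rewrite lee_fin /=; apply: le_trans (s0P (eps * N%:R) _); last first.
  rewrite mulrC -ler_pdivrMr//; apply/ltW/(lt_le_trans (truncnS_gt _)).
  by rewrite ler_nat.
have -> : unit_step N 1 - unit_step N 0 = T * (1 - expR (-1)) * (expR (- (N%:R / 2))) ^+ 2.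
  rewrite /unit_step /clock addn0 natrD opprD expRD -expRM_natl.
  have -> : 2%:R * (- (N%:R / 2)) = - N%:R :> R by field.
  by ring.
rewrite sqrtrM ?mulr_ge0 ?(ltW T0) ?(ltW e1)// sqrtr_sqr gtr0_norm ?expR_gt0//.
rewrite -/D; have -> : - (1 / 2 + eps) * N%:R = - (N%:R / 2) + - (eps * N%:R) by field.
rewrite expRD le_eqVlt; apply/orP; left; apply/eqP; field.
by rewrite (gt_eqF D0) (gt_eqF nv0) (gt_eqF (expR_gt0 _)).
Qed.

Lemma eigenrow_no_fast_decay (eps : R) : 0 < eps ->
  {ae P, forall w, ~ exists K s0, forall s, s0 <= s ->
     `|row_path T (fun t => X t w) u1 s| <= K * expR (- (1 / 2 + eps) * s) /\
     `|row_path T (fun t => X t w) u2 s| <= K * expR (- (1 / 2 + eps) * s)}.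
Proof.
move=> eps0.
have nslow : {ae P, forall w, forall k, ~ set_liminf (slow eps k) w}.
  apply: ae_foralln => k; apply: negligibleS (negligible_slow k eps0).
  by move=> w /= /contrapT.
apply: filterS2 solution_path_ae nslow => w [cX cB _ eqX] nslow [K [s0 sP]].
pose x1 := row_path T (fun t => X t w) u1; pose x2 := row_path T (fun t => X t w) u2.
pose nz := row_path T (fun t => B t w - B 0 w) v.
pose f s := x1 s - nz s.
have cf : continuous f by exact: continuous_drift.
have K0 : 0 <= K.
  have [h _] := sP s0 (lexx _); have := le_trans (normr_ge0 _) h.
  by rewrite pmulr_lge0 ?expR_gt0.
(* Two end values of [x1], plus the drift accumulated over one unit of time. *)
pose K' := K + K + (`|a| * K + `|be| * K).
apply: (nslow (Num.Def.truncn K')).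
exists (Num.Def.truncn s0).+1 => // N /= NN.
have s0N : s0 <= N%:R by apply/ltW/(lt_le_trans (truncnS_gt _)); rewrite ler_nat.
pose E := expR (- (1 / 2 + eps) * N%:R).
have mono r : N%:R <= r -> `|x1 r| <= K * E /\ `|x2 r| <= K * E.
  move=> Nr; have [h1 h2] := sP r (le_trans s0N Nr).
  have : K * expR (- (1 / 2 + eps) * r) <= K * E.
    by apply: ler_wpM2l => //; rewrite ler_expR ler_nM2l//; lra.
  by move=> h; split; [exact: le_trans h1 h|exact: le_trans h2 h].
have df : `|f (N%:R + 1) - f N%:R| <= (`|a| * K + `|be| * K) * E * (N%:R + 1 - N%:R).
  apply: (mean_value_le (df := fun s => - row_path T (fun t => X t w) (u1 *m A) s)) => //.
  - by rewrite lerDl.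
  - move=> r /andP[Nr _]; apply: row_path_derive => //.
    by apply: le_lt_trans Nr.
  - move=> r /andP[/ltW /mono [h1 h2] _]; rewrite normrN u1A row_pathD row_pathN !row_pathZ.
    apply: le_trans (ler_normB _ _) _; rewrite !normrM mulrDl -!mulrA.
    by apply: lerD; apply: ler_wpM2l.
have [g1 _] := mono _ (lexx _).
have [g2 _] : `|x1 (N%:R + 1)| <= K * E /\ `|x2 (N%:R + 1)| <= K * E by apply: mono; rewrite lerDl.
rewrite /slow /small_increments /= big_ord_recl big_ord0 addr0 /=.
have -> : (v *m (B (unit_step N 1) w - B (unit_step N 0) w)) 0 0 = nz (N%:R + 1) - nz N%:R.
  rewrite /nz /row_path !time_changedE ?addr_ge0// /unit_step addn0 natrD.
  by rewrite -[B _ w - B _ w](subrKA (B 0 w)) mulmxDr mulmxBr !mulmxBr !mxE; ring.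
have -> : nz (N%:R + 1) - nz N%:R = (x1 (N%:R + 1) - x1 N%:R) - (f (N%:R + 1) - f N%:R).
  by rewrite /f; ring.
apply: (@le_trans _ _ (K' * E)); last first.
  by apply: ler_wpM2r; [exact: expR_ge0|exact/ltW/truncnS_gt].
apply: le_trans (ler_normB _ _) _; rewrite /K' mulrDl; apply: lerD.
  by apply: le_trans (ler_normB _ _) _; rewrite mulrDl lerD.
have N1 : N%:R + 1 - N%:R = 1 :> R by ring.
by move: df; rewrite N1 mulr1.
Qed.

End Eigenrow.

(** * Growth along eigenrows when a < 1/2 *)

Section Growth.
Context (R : realType) (dsp : measure_display) (Omega : measurableType dsp).
Variables (P : probability Omega R) (T : R) (n m : nat).
Variables (A : 'M[R]_n.+1) (Sigma : 'M[R]_(n.+1, m)).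
Variables (B : R -> Omega -> 'cV[R]_m) (X : R -> Omega -> 'cV[R]_n.+1).
Hypothesis T0 : 0 < T.
Hypothesis hB : standard_wiener P T B.
Hypothesis hX : strong_solution P T A Sigma B X.
Variables (a be : R) (u1 u2 : 'rV[R]_n.+1) (i0 : 'I_m).
Hypothesis u1A : u1 *m A = a *: u1 - be *: u2.
Hypothesis u2A : u2 *m A = a *: u2 + be *: u1.
Hypothesis v0 : (u1 *m Sigma) 0 i0 != 0.
Let v1 := u1 *m Sigma.
Let v2 := u2 *m Sigma.

(** Index 0 is time 0, so that the first interval is the short initial one [0, clock T s]; the later
    ones are the grid steps. *)
Let sampling (s J : R) (N k : nat) : R :=
  if k is l.+1 then clock T (grid s J N l) else 0.

(** The real part of e^((a + i be) g) (v1 + i v2) at the left grid node g, with exponential 1 on the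
    initial interval. *)
Let weight (s J : R) (N k : nat) : 'rV[R]_m :=
  if k is l.+1 then ecos a be (grid s J N l) *: v1 - esin a be (grid s J N l) *: v2 else v1.

Let gridS (s J : R) N k : s < J -> grid s J N k < grid s J N k.+1.
Proof.
move=> sJ; rewrite /grid ltrD2l ltr_pM2l ?subr_gt0// ltr_pM2r ?invr_gt0 ?ltr0n//.
by rewrite ltr_nat.
Qed.

Let grid_ge (s J : R) N k : s < J -> s <= grid s J N k.
Proof.
by move=> sJ; rewrite /grid lerDl mulr_ge0 ?divr_ge0// subr_ge0 ltW.
Qed.

Let samplingT s J N k : 0 < s -> s < J -> 0 <= sampling s J N k < T.
Proof.
move=> s0 sJ; case: k => [|k] /=; first by rewrite lexx.
by apply: clock_itv => //; apply: le_trans (grid_ge _ _ sJ); exact: ltW.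
Qed.

Let sampling_incr s J N k : 0 < s -> s < J -> sampling s J N k < sampling s J N k.+1.
Proof.
move=> s0 sJ; case: k => [|k] /=; last by apply: clock_incr => //; exact: gridS.
rewrite -[ltLHS](clock0 T); apply: clock_incr => //.
exact: lt_le_trans (grid_ge _ _ sJ).
Qed.

Let mesh (k : nat) : R := k.+1%:R^-1.
Let horizon (k j : nat) : R := mesh k + j.+1%:R.

Let mesh0 k : 0 < mesh k. Proof. by rewrite invr_gt0. Qed.
Let mesh_horizon k j : mesh k < horizon k j. Proof. by rewrite ltrDl. Qed.

(* N refines the Riemann sum, j pushes its horizon to infinity and k shrinks the
   initial interval; these limits are pathwise and taken in that order, hence the
   nested limits inferior. *)
Let small (de : R) (k j N : nat) :=
  small_increments B (n := N.+2) (sampling (mesh k) (horizon k j) N)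
    (weight (mesh k) (horizon k j) N) (2 * (de * Num.sqrt (clock T (mesh k)))).

Let small_liminf (de : R) :=
  set_liminf (fun k => set_liminf (fun j => set_liminf (small de k j))).

Let measurable_small de k j N : measurable (small de k j N).
Proof. by apply: (measurable_small_increments hB) => l _; exact: samplingT. Qed.

(** The threshold in [small] is proportional to the standard deviation of the initial scalar
    increments, so the bound is the same for all k, j, N and survives the three limits. *)
Let small_liminf_le de : 0 < de ->
  measurable (small_liminf de) /\
  (P (small_liminf de) <= (8 * de / `|v1 0 i0|)%:E)%E.
Proof.
move=> de0.
have m1 k j : measurable (set_liminf (small de k j)) by exact: measurable_set_liminf.
have m2 k : measurable (set_liminf (fun j => set_liminf (small de k j))).
  by apply: measurable_set_liminf => j.
split; first by apply: measurable_set_liminf => k.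
apply: (@set_liminf_le _ _ _ _ _ _ 0%N) => // k _.
apply: (@set_liminf_le _ _ _ _ _ _ 0%N) => // j _.
apply: (@set_liminf_le _ _ _ _ _ _ 0%N) => // N _.
have c0 : 0 < clock T (mesh k) by rewrite -(clock0 T) clock_incr.
have sd0 : 0 < Num.sqrt (clock T (mesh k)) by rewrite sqrtr_gt0.
have e0 : 0 < 2 * (de * Num.sqrt (clock T (mesh k))) by rewrite !mulr_gt0.
apply: le_trans (small_increments_le hB (k0 := ord0) (i0 := i0) _ _ _ e0) _ => //.
- by move=> l _; exact: samplingT.
- by move=> l _; exact: sampling_incr.
rewrite lee_fin /= subr0 /grid mul0r mulr0 addr0.
rewrite le_eqVlt; apply/orP; left; apply/eqP; field.
by rewrite normr_eq0 v0 gt_eqF.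
Qed.

Section Path.
Variable w : Omega.
Hypothesis cX : {within `[0, T[, continuous (fun t => X t w)}.
Hypothesis cB : {within `[0, T[, continuous (fun t => B t w)}.
Hypothesis X0 : X 0 w = 0.
Hypothesis eqX : forall t, 0 <= t < T -> X t w =
  (\col_i \int[lebesgue_measure]_(r in `[0, t]) (- (T - r)^-1 * (A *m X r w) i 0))
  + Sigma *m (B t w - B 0 w).
Let x1 := row_path T (fun t => X t w) u1.
Let x2 := row_path T (fun t => X t w) u2.
Let noise v := row_path T (fun t => B t w - B 0 w) v.
Let f1 s := x1 s - noise v1 s.
Let f2 s := x2 s - noise v2 s.
Let Q (s : R) := ecos a be s * x1 s - esin a be s * x2 s.

Let cx1 : continuous x1. Proof. exact: continuous_row_path. Qed.
Let cx2 : continuous x2. Proof. exact: continuous_row_path. Qed.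
Let cf1 : continuous f1. Proof. exact: continuous_drift. Qed.
Let cf2 : continuous f2. Proof. exact: continuous_drift. Qed.

Let df1 (r : R) : 0 < r -> is_derive r 1 f1 (- (a * x1 r - be * x2 r)).
Proof.
move=> r0; have := row_path_derive u1 T0 cX eqX r0.
by rewrite u1A row_pathD row_pathN !row_pathZ.
Qed.

Let df2 (r : R) : 0 < r -> is_derive r 1 f2 (- (a * x2 r + be * x1 r)).
Proof.
move=> r0; have := row_path_derive u2 T0 cX eqX r0.
by rewrite u2A row_pathD !row_pathZ.
Qed.

Let noiseE v s : 0 <= s -> noise v s = (v *m (B (clock T s) w - B 0 w)) 0 0.
Proof. by move=> s0; rewrite /noise /row_path time_changedE. Qed.

Let noise0 v : noise v 0 = 0.
Proof. by rewrite noiseE// clock0 subrr mulmx0 mxE. Qed.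

Let weighted_incrementsE s J N : 0 < s -> s < J ->
  \sum_(k < N.+2) (weight s J N k *m
     (B (sampling s J N k.+1) w - B (sampling s J N k) w)) 0 0 =
  noise v1 s + \sum_(k < N.+1)
     (ecos a be (grid s J N k) * (x1 (grid s J N k.+1) - f1 (grid s J N k.+1)
        - (x1 (grid s J N k) - f1 (grid s J N k)))
    - esin a be (grid s J N k) * (x2 (grid s J N k.+1) - f2 (grid s J N k.+1)
        - (x2 (grid s J N k) - f2 (grid s J N k)))).
Proof.
move=> s0 sJ; rewrite big_ord_recl /=; congr (_ + _).
  by rewrite noiseE ?(ltW s0)// /grid mul0r mulr0 addr0.
apply: eq_bigr => k _; rewrite /= /bump /= add1n.
have g0 l : 0 <= grid s J N l by apply: le_trans (grid_ge _ _ sJ); exact: ltW.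
have nE v l : (v *m (B (clock T (grid s J N l.+1)) w - B (clock T (grid s J N l)) w)) 0 0
   = noise v (grid s J N l.+1) - noise v (grid s J N l).
  rewrite !noiseE// -[in LHS](subrKA (B 0 w)) mulmxDr mxE; congr (_ + _).
  by rewrite -opprB mulmxN mxE.
have combE (c1 c2 : R) (D : 'cV[R]_m) :
    ((c1 *: v1 - c2 *: v2) *m D) 0 0 = c1 * (v1 *m D) 0 0 - c2 * (v2 *m D) 0 0.
  by rewrite mulmxBl -!scalemxAl !mxE.
rewrite combE !nE /f1 /f2; ring.
Qed.

(** The weighted increments equal [Q] at the horizon, minus the Riemann error, minus the initial
    error [Q - noise v1] at [mesh k]. With [eta] half the threshold in [small], these are at most
    eta / 2, eta / 2 and eta. *)
Lemma vanishing_limit_small (K p s0 de : R) : 0 < p -> 0 < de ->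
  (forall s, s0 < s -> `|Q s| <= K * expR (- p * s)) -> small_liminf de w.
Proof.
move=> p0 de0 QK.
have [d d0 dP] := rotated_increment cx1 cx2 cf1 cf2 df1 df2 1 ltr01.
(* The second bound gives mesh^2 <= de^2 T mesh / 2 <= de^2 clock (mesh), that is, mesh <= eta. *)
pose th := Num.min d (de ^+ 2 * T / 2).
have th0 : 0 < th by rewrite lt_min d0 divr_gt0// mulr_gt0// exprn_gt0.
exists (Num.Def.truncn th^-1) => // k /= kth.
have sth : mesh k < th.
  rewrite invf_plt ?posrE//; apply: lt_le_trans (truncnS_gt _) _.
  by rewrite ler_nat.
have s1 : mesh k <= 1 by rewrite invf_le1// ler1n.
move: sth; rewrite lt_min => /andP[sd sdT].
have sk0 := mesh0 k.
pose eta := de * Num.sqrt (clock T (mesh k)).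
have c0 : 0 < clock T (mesh k) by rewrite -(clock0 T) clock_incr.
have eta0 : 0 < eta by rewrite mulr_gt0// sqrtr_gt0.
have s_eta : mesh k <= eta.
  rewrite -(@ler_pXn2r _ 2) ?nnegrE ?(ltW sk0) ?(ltW eta0)// exprMn sqr_sqrtr ?(ltW c0)//.
  (* From e^(- h) <= 1 / (1 + h) <= 1 - h / 2 for 0 < h <= 1. *)
  have h : mesh k / 2 <= 1 - expR (- mesh k).
    rewrite lerBrDl addrC -lerBrDl expRN.
    have h1 := expR_ge1Dx (mesh k).
    have h2 : (expR (mesh k))^-1 <= (1 + mesh k)^-1 by rewrite lef_pV2 ?posrE ?expR_gt0//; lra.
    apply: le_trans h2 _; rewrite -div1r ler_pdivrMr; last lra.
    by nra.
  have -> : clock T (mesh k) = T * (1 - expR (- mesh k)) by rewrite /clock; ring.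
  apply: (@le_trans _ _ (de ^+ 2 * (T * (mesh k / 2)))); last first.
    by rewrite ler_pM2l ?exprn_gt0// ler_pM2l.
  have -> : de ^+ 2 * (T * (mesh k / 2)) = (de ^+ 2 * T / 2) * mesh k by field.
  by rewrite expr2 ler_pM2r// ltW.
(* [rotated_increment] from time 0, where the weights are 1 and 0 and X vanishes. *)
have Q0 : `|Q (mesh k) - noise v1 (mesh k)| <= mesh k.
  have := dP 0 (mesh k) (lexx _) (ltW sk0) s1; rewrite subr0 mul1r => /(_ sd).
  have x0 u : row_path T (fun t => X t w) u 0 = 0.
    by rewrite /row_path time_changedE// clock0 X0 mulmx0 mxE.
  have e1 : ecos a be 0 = 1 by rewrite /ecos !mulr0 expR0 cos0 mulr1.
  have e2 : esin a be 0 = 0 by rewrite /esin !mulr0 sin0 mulr0.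
  have -> : Q (mesh k) - noise v1 (mesh k) = Q (mesh k) - Q 0 -
      (ecos a be 0 * (x1 (mesh k) - f1 (mesh k) - (x1 0 - f1 0))
       - esin a be 0 * (x2 (mesh k) - f2 (mesh k) - (x2 0 - f2 0))).
    by rewrite /Q e1 e2 /f1 /f2 /x1 /x2 !x0 !noise0; ring.
  by [].
have [s2 s2P] := expR_small K (divr_gt0 eta0 (ltr0Sn R 1)).
exists (Num.Def.truncn (Num.max s0 (s2 / p))).+1 => // j /= jP.
have jJ : Num.max s0 (s2 / p) < horizon k j.
  apply: lt_le_trans (truncnS_gt _) _; apply: (@le_trans _ _ j%:R); first by rewrite ler_nat.
  by rewrite /horizon -natr1; have := ltW sk0; lra.
move: jJ; rewrite gt_max => /andP[j1 j2].
have QJ : `|Q (horizon k j)| <= eta / 2.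
  apply: le_trans (QK _ j1) _; rewrite mulNr; apply: s2P.
  by rewrite mulrC -ler_pdivrMr// ltW.
have [N0 N0P] := riemann_sum_cvg cx1 cx2 cf1 cf2 df1 df2 (ltW sk0) (ltW (mesh_horizon k j)) (divr_gt0 eta0 (ltr0Sn R 1)).
exists N0 => // N /= /N0P RN.
rewrite /small /small_increments /= weighted_incrementsE//.
move: RN; set S := (\sum_(_ < _) _).
rewrite -/(Q _) -/(Q _) -/eta => RN.
have -> : noise v1 (mesh k) + S = Q (horizon k j) - (Q (horizon k j) - Q (mesh k) - S)
   - (Q (mesh k) - noise v1 (mesh k)) by ring.
apply: le_trans (ler_normB _ _) _.
have := ler_normB (Q (horizon k j)) (Q (horizon k j) - Q (mesh k) - S).
by move: RN QJ Q0 s_eta; rewrite -/(Q _); lra.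
Qed.

(** [Q] converges exponentially fast. A zero limit would put w in every [small_liminf de], so
    eventually |Q| is at least half of a nonzero limit, while |Q| <= e^(a s) (|x1| + |x2|). *)
Lemma nonvanishing_limit_growth (kap : R) : a < kap ->
  terminal_rate T (fun t => B t w) kap ->
  ~ (forall de, 0 < de -> small_liminf de w) ->
  exists c s0, 0 < c /\ forall s, s0 <= s ->
    c <= expR (a * s) * (`|x1 s| + `|x2 s|).
Proof.
move=> ak rate ns; have p0 : 0 < kap - a by rewrite subr_gt0.
have [l1 [K1 [s1 r1]]] := rate v1.
have [l2 [K2 [s2 r2]]] := rate v2.
pose s0 := Num.max 0 (Num.max s1 s2).
have s00 : 0 <= s0 by rewrite le_max lexx.
pose C := Num.max K1 K2.
have n1C r : s0 < r -> `|x1 r - f1 r - l1| <= C * expR (- kap * r).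
  move=> /ltW; rewrite !ge_max => /and3P[_ h _].
  rewrite /f1 opprB addrCA subrr addr0; apply: le_trans (r1 r h) _.
  by rewrite ler_wpM2r ?expR_ge0// le_max lexx.
have n2C r : s0 < r -> `|x2 r - f2 r - l2| <= C * expR (- kap * r).
  move=> /ltW; rewrite !ge_max => /and3P[_ _ h].
  rewrite /f2 opprB addrCA subrr addr0; apply: le_trans (r2 r h) _.
  by rewrite ler_wpM2r ?expR_ge0// le_max lexx orbT.
have [l [K QK]] := rotated_limit cf1 cf2 df1 df2 ak s00 n1C n2C.
have l0 : 0 < `|l|.
  rewrite normr_gt0; apply/eqP => l0; apply: ns => de de0.
  apply: (vanishing_limit_small p0 de0) => s hs.
  by have := QK s hs; rewrite l0 subr0; exact.
have [s3 s3P] := expR_small K (divr_gt0 l0 (ltr0Sn R 1)).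
exists (`|l| / 2), (Num.max (s0 + 1) (s3 / (kap - a))); split; first by rewrite divr_gt0.
move=> s; rewrite ge_max => /andP[h1 h2].
have s0s : s0 < s by apply: lt_le_trans h1; rewrite ltrDl.
have Ql : `|Q s - l| <= `|l| / 2.
  apply: le_trans (QK s s0s) _; rewrite mulNr; apply: s3P.
  by rewrite mulrC -ler_pdivrMr.
have lQ : `|l| / 2 <= `|Q s|.
  have := ler_normB (Q s) (Q s - l).
  have -> : Q s - (Q s - l) = l by ring.
  by lra.
apply: le_trans lQ _; rewrite /Q mulrDr; apply: le_trans (ler_normB _ _) _.
rewrite /ecos /esin !normrM (gtr0_norm (expR_gt0 _)).
by apply: lerD; rewrite -mulrA ler_wpM2l ?expR_ge0// ler_piMl// ler_norml
  ?cos_geN1 ?cos_le1 ?sin_geN1 ?sin_le1.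
Qed.

End Path.

Lemma eigenrow_growth : 0 <= a -> a < 1 / 2 ->
  {ae P, forall w, exists c s0, 0 < c /\ forall s, s0 <= s ->
    c <= expR (a * s) * (`|row_path T (fun t => X t w) u1 s|
                         + `|row_path T (fun t => X t w) u2 s|)}.
Proof.
move=> a0 a12.
pose kap := (a + 1 / 2) / 2.
have k0 : 0 < kap by rewrite /kap; lra.
have k12 : kap < 1 / 2 by rewrite /kap; lra.
have ak : a < kap by rewrite /kap; lra.
have p0 : 0 < kap - a by rewrite subr_gt0.
have nsmall : {ae P, forall w, ~ (forall de, 0 < de -> small_liminf de w)}.
  apply: negligible_approx => e e0.
  have nv0 : 0 < `|v1 0 i0| by rewrite normr_gt0.
  (* This value of de makes the bound 8 de / |v1_i0| equal to e. *)
  have de0 : 0 < e * `|v1 0 i0| / 8 by rewrite divr_gt0 ?mulr_gt0.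
  have [mS SP] := small_liminf_le de0.
  exists (small_liminf (e * `|v1 0 i0| / 8)); split => //.
    by move=> w /= /contrapT; exact.
  apply: le_trans SP _; rewrite lee_fin le_eqVlt; apply/orP; left; apply/eqP; field.
  by rewrite gt_eqF.
apply: filterS3 (solution_path_ae hB hX) (terminal_rate_ae T0 hB k0 k12) nsmall.
move=> w [cX cB X0 eqX] rate ns.
exact: (nonvanishing_limit_growth cX cB X0 eqX ak rate ns).
Qed.

End Growth.

(** * Spectral projections *)

Section SpectralProjection.
Context (R : realType) (d : nat) (A : 'M[R]_d.+1) (p : nat).
Variables (a : 'I_p -> R) (f : 'I_p -> {poly R}).
Hypothesis ha : forall i j : 'I_p, (i < j)%N -> a i < a j.
Hypothesis hf : spectral_factorization A a f.
Variables (dim : 'I_p -> nat) (b : forall j, 'M[R]_(d.+1, dim j)).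
Hypothesis hb : forall j, column_basis (polyker A (f j)) (b j).
Local Notation C := (complex R).
Local Notation toC := (real_complex R).
Local Notation reC := (@complex.Re R).
Local Notation imC := (@complex.Im R).
Local Notation AC := (map_mx toC A).

Lemma mul_eigenrow_horner (F : fieldType) n (M : 'M[F]_n.+1) (u : 'rV[F]_n.+1) l (q : {poly F}) :
  u *m M = l *: u -> u *m horner_mx M q = q.[l] *: u.
Proof.
move=> uM; elim/poly_ind: q => [|q c IH].
  by rewrite rmorph0 mulmx0 horner0 scale0r.
rewrite rmorphD rmorphM /= horner_mx_X horner_mx_C mulmxDr mulmxA IH -scalemxAl uM.
by rewrite scalerA mul_mx_scalar hornerMXaddC scalerDl.
Qed.

(** A common complex root would have both a_i and a_j as its real part. *)
Lemma spectral_factor_coprime i j : i != j -> coprimep (f i) (f j).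
Proof.
case: hf => _ fa ij; rewrite -(coprimep_map toC).
apply: contraT => /closed_rootP[z]; rewrite root_gcd => /andP[zi zj].
have := fa _ _ zi; rewrite (fa _ _ zj) => aij.
have : (i != j :> nat) by [].
by rewrite neq_ltn => /orP[] /ha; rewrite aij ltxx.
Qed.

Lemma coprimep_prodr (F : fieldType) (I : eqType) (q : {poly F}) (g : I -> {poly F}) (r : seq I) (Q : pred I) :
  {in r, forall i, Q i -> coprimep q (g i)} -> coprimep q (\prod_(i <- r | Q i) g i).
Proof.
elim: r => [|i r IH] H; first by rewrite big_nil coprimep1.
have IH' : coprimep q (\prod_(j <- r | Q j) g j).
  by apply: IH => j jr; apply: H; rewrite in_cons jr orbT.
rewrite big_cons; case: ifP => // Qi; rewrite coprimepMr IH' andbT.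
by apply: H => //; rewrite mem_head.
Qed.

Let cofac j := \prod_(k | k != j) f k.

(** Bezout for f_j and the product of the other factors: e_j is 1 modulo f_j and 0 modulo the
    others, so e_j(A) is the projection onto V_j along the other V_k. *)
Let exists_idempotents : exists e g : 'I_p -> {poly R},
  (forall j, e j + g j * f j = 1) /\ (forall j, cofac j %| e j).
Proof.
have H j : exists eg : {poly R} * {poly R}, eg.1 + eg.2 * f j = 1 /\ cofac j %| eg.1.
  have /Bezout_eq1_coprimepP[[u v] /= uv] : coprimep (f j) (cofac j).
    by apply: coprimep_prodr => k _ kj; rewrite spectral_factor_coprime// eq_sym.
  by exists (v * cofac j, u); split => /=; [rewrite addrC|rewrite dvdp_mull].
have [eg egP] := choice H.
by exists (fun j => (eg j).1), (fun j => (eg j).2); split => j; have [] := egP j.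
Qed.

Let horner_mxM (q1 q2 : {poly R}) : horner_mx A (q1 * q2) = horner_mx A q1 *m horner_mx A q2.
Proof. exact: rmorphM. Qed.

Let dvdp_prod_factors (h : {poly R}) (r : seq 'I_p) :
  (forall j, f j %| h) -> uniq r -> \prod_(j <- r) f j %| h.
Proof.
move=> fh; elim: r => [|j r IH] /=; first by rewrite big_nil dvd1p.
case/andP => jr ur; rewrite big_cons Gauss_dvdp ?fh ?IH//.
apply: coprimep_prodr => k kr _; apply: spectral_factor_coprime.
by apply: contraNneq jr => ->.
Qed.

(** [Pi j] is the projection e_j(A) followed by a left inverse of the basis [b j], so that
    [b j *m Pi j] is e_j(A) itself, which fixes the left eigenrows with real part a_j. *)
Lemma spectral_coordE : exists Pi : forall j, 'M[R]_(dim j, d.+1),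
  [/\ forall j x, spectral_coord A f b j x = Pi j *m x,
      forall j, Pi j *m horner_mx A (f j) = 0
    & forall j (u : 'rV[C]_d.+1) l, u *m AC = l *: u -> reC l = a j ->
       map_mx reC u *m b j *m Pi j = map_mx reC u /\
       map_mx imC u *m b j *m Pi j = map_mx imC u].
Proof.
have [e [g [eg cofe]]] := exists_idempotents.
have [fmin fa] := hf.
pose E j := horner_mx A (e j).
have fj_dvd i j : i != j -> f j %| e i.
  move=> ij; apply: dvdp_trans (cofe i); rewrite /cofac (bigD1 j) 1?eq_sym//.
  exact: dvdp_mulr.
have fE j : horner_mx A (f j) *m E j = 0.
  rewrite -horner_mxM; have /dvdpP[q ->] := cofe j.
  have -> : f j * (q * cofac j) = q * mxminpoly A.
    by rewrite fmin (bigD1 j)//= mulrCA.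
  by rewrite horner_mxM mx_root_minpoly mulmx0.
have E0 i j (y : 'cV[R]_d.+1) : i != j -> polyker A (f j) y -> E i *m y = 0.
  move=> ij yj; rewrite /E; have /dvdpP[q ->] := fj_dvd _ _ ij.
  by rewrite horner_mxM -mulmxA yj mulmx0.
have E1 j (y : 'cV[R]_d.+1) : polyker A (f j) y -> E j *m y = y.
  move=> yj; rewrite /E; have -> : e j = 1 - g j * f j by rewrite -(eg j) addrK.
  by rewrite rmorphB rmorph1 /= horner_mxM mulmxBl -mulmxA yj mulmx0 subr0 mul1mx.
(* The sum of the e_k minus 1 is divisible by each f_j, hence, these being coprime, by the minimal
   polynomial. *)
have Esum : \sum_k E k = 1.
  apply/eqP; rewrite -subr_eq0 -(rmorph1 (horner_mx A)) /E -rmorph_sum -rmorphB /=.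
  have /dvdpP[q ->] : mxminpoly A %| \sum_k e k - 1.
    rewrite fmin; apply: dvdp_prod_factors; last exact: index_enum_uniq.
    move=> j; rewrite (bigD1 j)//= -(eg j); set S := \sum_(_ | _) _.
    have -> : e j + S - (e j + g j * f j) = S - g j * f j by ring.
    apply: dvdp_sub; last exact: dvdp_mulIr.
    apply: (big_ind (fun h => f j %| h)) => [|x y|k kj]; first exact: dvdp0.
      exact: dvdp_add.
    exact: fj_dvd.
  by rewrite horner_mxM mx_root_minpoly mulmx0.
pose L j : 'M[R]_(dim j, d.+1) := (pinvmx (b j)^T)^T.
have Lb j : L j *m b j = 1%:M.
  have [rf _] := hb j.
  by rewrite /L -[b j in X in _ *m X]trmxK -trmx_mul mulmxVp// trmx1.
have bL j (y : 'cV[R]_d.+1) : polyker A (f j) y -> b j *m (L j *m y) = y.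
  have [_ V] := hb j; rewrite V => -[c _ <-].
  by rewrite [L j *m _]mulmxA Lb mul1mx.
have bLE j : b j *m (L j *m E j) = E j.
  have colK (M : 'M[R]_d.+1) r k : M r k = (M *m delta_mx k (0 : 'I_1)) r 0.
    by rewrite -colE mxE.
  apply/matrixP => r k; rewrite [LHS]colK [RHS]colK -!mulmxA bL//.
  by rewrite /polyker /= mulmxA fE mul0mx.
exists (fun j => L j *m E j); split.
- move=> j x; rewrite /spectral_coord.
  (* The chosen value is unambiguous: [E j] isolates the j-th term of any decomposition, and [L j]
     recovers its coordinates. *)
  set S := (X in xget 0 X); have Sx : S (L j *m E j *m x).
    exists (fun k => E k *m x); split.
    + by move=> k; rewrite /polyker /= mulmxA fE mul0mx.
    + by rewrite -mulmx_suml Esum mul1mx.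
    + by rewrite -[L j *m E j *m x]mulmxA bL// /polyker /= mulmxA fE mul0mx.
  have [y [yk xE yj]] := xgetPex 0 (ex_intro S _ Sx).
  rewrite -[LHS]mul1mx -(Lb j) -mulmxA -yj -mulmxA; congr (_ *m _).
  rewrite xE mulmx_sumr (bigD1 j)//= E1// big1 ?addr0// => k kj.
  by rewrite (E0 _ k)// eq_sym.
- by move=> j; rewrite -mulmxA /E -horner_mxM mulrC horner_mxM fE mulmx0.
move=> j u l ul lj.
have uE k : u *m map_mx toC (E k) = (map_poly toC (e k)).[l] *: u.
  by rewrite /E map_horner_mx; exact: mul_eigenrow_horner.
(* f_k e_k annihilates A, and f_k(l) is nonzero because Re l = a_j differs from a_k; hence e_k(l) u
   = 0. *)
have uE0 k : k != j -> u *m map_mx toC (E k) = 0.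
  move=> kj; rewrite uE.
  have : (map_poly toC (f k)).[l] * (map_poly toC (e k)).[l] *: u = 0.
    rewrite -hornerM -rmorphM -(mul_eigenrow_horner _ ul) -map_horner_mx.
    by rewrite horner_mxM fE map_mx0 mulmx0.
  move=> /eqP; rewrite -scalerA scaler_eq0 => /orP[|/eqP//] /eqP fk0.
  have := fa k l; rewrite rootE fk0 eqxx => /(_ isT); rewrite lj => akj.
  have : (k != j :> nat) by [].
  by rewrite neq_ltn => /orP[] /ha; rewrite akj ltxx.
have uEj : u *m map_mx toC (E j) = u.
  have : u *m map_mx toC (\sum_k E k) = u by rewrite Esum map_mx1 mulmx1.
  rewrite raddf_sum mulmx_sumr (bigD1 j)//= big1 ?addr0// => k; exact: uE0.
by split; rewrite -!mulmxA bLE; [rewrite -Re_mulmx_real|rewrite -Im_mulmx_real]; rewrite uEj.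
Qed.

Lemma spectral_rows_annihilated (Pi : forall j, 'M[R]_(dim j, d.+1)) j (i : 'I_(dim j)) :
  Pi j *m horner_mx A (f j) = 0 ->
  exists ls : seq C, (forall l, l \in ls -> reC l = a j) /\
    map_mx toC (row i (Pi j)) *m horner_mx AC (\prod_(l <- ls) ('X - l%:P)) = 0.
Proof.
move=> Pif; have [fmin fa] := hf.
have f0 : f j != 0.
  have := monic_neq0 (mxminpoly_monic A); rewrite fmin.
  by apply: contra_neq => fj0; rewrite (bigD1 j)//= fj0 mul0r.
have [ls lsE] := closed_field_poly_normal (map_poly toC (f j)).
have lc0 : lead_coef (map_poly toC (f j)) != 0 by rewrite lead_coef_eq0 map_poly_eq0.
exists ls; split.
  move=> l lls; apply: fa; rewrite lsE rootZ//.
  by rewrite root_prod_XsubC.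
have : map_mx toC (row i (Pi j)) *m horner_mx AC (map_poly toC (f j)) = 0.
  rewrite -map_horner_mx -map_mxM -row_mul Pif.
  by apply/matrixP => r k; rewrite !mxE.
rewrite lsE -mul_polyC rmorphM /= horner_mx_C.
rewrite -[_ * _]/(_ *m _) mul_scalar_mx -scalemxAr => /eqP.
by rewrite scaler_eq0 (negbTE lc0) => /eqP.
Qed.

End SpectralProjection.

(** If the real part of an eigenrow vanishes, multiplying the row by i moves its nonzero imaginary
    part there. *)
Lemma eigenrow_real_part (R : realType) (n : nat) (A : 'M[R]_n.+1) (x : R) :
  ReSpec A x -> exists (u : 'rV[complex R]_n.+1) (l : complex R),
  [/\ u *m map_mx (real_complex R) A = l *: u, complex.Re l = x
    & map_mx (@complex.Re R) u != 0].
Proof.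
move=> [l /eigenvalueP[u ul u0] <-].
have [re0|re0] := eqVneq (map_mx (@complex.Re R) u) 0; last by exists u, l.
exists ('i%C *: u), l; split => //; first by rewrite -scalemxAl ul !scalerA mulrC.
apply: contra_neq u0 => iu0; apply/matrixP => i j.
have := congr1 (fun M : 'rV[R]_n.+1 => M i j) re0.
have := congr1 (fun M : 'rV[R]_n.+1 => M i j) iu0.
rewrite !mxE; case: (u i j) => y z /=.
by rewrite mul0r mul1r sub0r => /eqP; rewrite oppr_eq0 => /eqP -> ->.
Qed.

(** * Spectral components *)

Section Assembly.
Context {R : realType}.

Lemma euclid_norm_ge0 n (v : 'cV[R]_n) : 0 <= euclid_norm v.
Proof. exact: sqrtr_ge0. Qed.

Lemma euclid_norm_le_sum n (v : 'cV[R]_n) : euclid_norm v <= \sum_i `|v i 0|.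
Proof.
have S0 : 0 <= \sum_i `|v i 0| by exact: sumr_ge0.
rewrite /euclid_norm -(ger0_norm S0) -sqrtr_sqr ler_wsqrtr// expr2 mulr_suml.
apply: ler_sum => i _; rewrite -(real_normK (num_real (v i 0))) expr2.
by apply: ler_wpM2l => //; rewrite (bigD1 i)//= lerDl sumr_ge0.
Qed.

Lemma coord_le_euclid_norm n (v : 'cV[R]_n) i : `|v i 0| <= euclid_norm v.
Proof.
rewrite -sqrtr_sqr ler_wsqrtr// (bigD1 i)//= lerDl.
by apply: sumr_ge0 => k _; exact: sqr_ge0.
Qed.

Lemma row_mul_le_euclid_norm n (r : 'rV[R]_n) (v : 'cV[R]_n) :
  `|(r *m v) 0 0| <= (\sum_i `|r 0 i|) * euclid_norm v.
Proof.
rewrite mxE mulr_suml; apply: le_trans (ler_norm_sum _ _ _) _; apply: ler_sum => i _.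
by rewrite normrM ler_wpM2l// coord_le_euclid_norm.
Qed.

Lemma powR_clock (T q s : R) : 0 < T ->
  (T - clock T s) `^ q = T `^ q * expR (- (q * s)).
Proof.
move=> T0; have -> : T - clock T s = T * expR (- s) by rewrite /clock; ring.
rewrite powRM ?(ltW T0) ?expR_ge0//; congr (_ * _).
by rewrite /powR gt_eqF ?expR_gt0// expRK mulrN.
Qed.

Lemma limf_esup_pinfty (F : set_system R) (g : R -> R) :
  (forall V, F V -> forall M, exists2 t, V t & M < g t) ->
  limf_esup (fun t => (g t)%:E) F = +oo%E.
Proof.
move=> H; rewrite limf_esupE; apply/eqP; rewrite -leye_eq.
apply: le_ereal_inf_tmp => _ [V FV <-].
rewrite leye_eq; apply/eqP; apply/eqyP => M M0.
have [t Vt Mt] := H V FV M.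
apply: le_trans (ereal_sup_ubound _); last by exists t.
by rewrite lee_fin ltW.
Qed.

End Assembly.

Section SpectralComponents.
Context (R : realType) (dsp : measure_display) (Omega : measurableType dsp).
Variables (P : probability Omega R) (T : R) (d m : nat).
Variables (A : 'M[R]_d.+1) (Sigma : 'M[R]_(d.+1, m)).
Variables (B : R -> Omega -> 'cV[R]_m) (X : R -> Omega -> 'cV[R]_d.+1).
Hypothesis T0 : 0 < T.
Hypothesis hB : standard_wiener P T B.
Hypothesis hX : strong_solution P T A Sigma B X.
Variables (p : nat) (a : 'I_p -> R) (f : 'I_p -> {poly R}).
Hypothesis ha : forall i j : 'I_p, (i < j)%N -> a i < a j.
Hypothesis hspec : range a = ReSpec A.
Hypothesis hf : spectral_factorization A a f.
Variables (dim : 'I_p -> nat) (b : forall j, 'M[R]_(d.+1, dim j)).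
Hypothesis hb : forall j, column_basis (polyker A (f j)) (b j).
Let Xnorm (j : 'I_p) (w : Omega) (t : R) : R :=
  euclid_norm (spectral_coord A f b j (X t w)).

Let Xnorm_ge0 j w t : 0 <= Xnorm j w t. Proof. exact: euclid_norm_ge0. Qed.

Lemma spectral_component_upper (kap : R) j : 0 < kap -> kap < a j -> kap < 1 / 2 ->
  {ae P, forall w, exists K s0, forall s, s0 <= s ->
     Xnorm j w (clock T s) <= K * expR (- kap * s)}.
Proof.
move=> k0 ka k12.
have [Pi [PiE Pi0 _]] := spectral_coordE ha hf hb.
apply: filterS2 (solution_path_ae hB hX) (terminal_rate_ae T0 hB k0 k12).
move=> w [cX cB _ eqX] rate.
have rows i : exists Ks : R * R, forall s, Ks.2 <= s ->
    `|row_path T (fun t => X t w) (row i (Pi j)) s| <= Ks.1 * expR (- kap * s).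
  have [ls [lsa lsr]] := spectral_rows_annihilated hf i (Pi0 j).
  have [K [s0 sP]] := generalized_eigenrow_decay T0 cX cB eqX ka rate lsa lsr.
  have re : map_mx (@complex.Re R) (map_mx (real_complex R) (row i (Pi j))) = row i (Pi j).
    by apply/matrixP => r k; rewrite !mxE.
  by exists (K, s0) => s /sP[]; rewrite re.
have [Ks KsP] := choice rows.
exists (\sum_i (Ks i).1), (\sum_i `|(Ks i).2|) => s hs.
have s_0 : 0 <= s by apply: le_trans hs; exact: sumr_ge0.
rewrite /Xnorm PiE mulr_suml; apply: le_trans (euclid_norm_le_sum _) _.
apply: ler_sum => i _.
have -> : (Pi j *m X (clock T s) w) i 0 = row_path T (fun t => X t w) (row i (Pi j)) s.
  by rewrite /row_path time_changedE// -row_mul [RHS]mxE.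
apply: KsP; apply: le_trans hs; apply: le_trans (ler_norm _) _.
by rewrite (bigD1 i)//= lerDl sumr_ge0.
Qed.

(** An eigenrow u satisfies u = (u b_j) Pi_j, so u x depends only on the j-th coordinates, with
    constant the sum of the absolute entries of u b_j. Full rank of [Sigma] makes right
    multiplication by it injective on rows, so [u1 *m Sigma] has a nonzero entry. *)
Lemma spectral_component_eigenrow j : \rank Sigma = d.+1 -> 
  exists (u1 u2 : 'rV[R]_d.+1) (be : R) (i0 : 'I_m) (M : R),
  [/\ u1 *m A = a j *: u1 - be *: u2, u2 *m A = a j *: u2 + be *: u1,
      (u1 *m Sigma) 0 i0 != 0, 0 < M
    & forall x : 'cV[R]_d.+1, `|(u1 *m x) 0 0| <= M * euclid_norm (spectral_coord A f b j x) /\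
                `|(u2 *m x) 0 0| <= M * euclid_norm (spectral_coord A f b j x)].
Proof.
move=> rS; have [Pi [PiE _ Piu]] := spectral_coordE ha hf hb.
have : ReSpec A (a j) by rewrite -hspec; exists j.
move=> /eigenrow_real_part[u [l [ul la u0]]].
have [P1 P2] := Piu j u l ul la.
have ul' : u *m map_mx (real_complex R) A = l *: u + 0 by rewrite addr0.
have reA := Re_row_mul ul'; have imA := Im_row_mul ul'.
rewrite !map_mx0 !addr0 la in reA imA.
set u1 := map_mx (@complex.Re R) u in u0 P1 reA imA.
set u2 := map_mx (@complex.Im R) u in P2 reA imA.
have v0 : u1 *m Sigma != 0 by rewrite mulmx_free_eq0// /row_free rS.
have [i0 vi0] : exists i0, (u1 *m Sigma) 0 i0 != 0 by exact/rV0Pn.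
pose N (v : 'rV[R]_d.+1) := \sum_i `|(v *m b j) 0 i|.
have N0 v : 0 <= N v by exact: sumr_ge0.
have vP v x : v *m b j *m Pi j = v -> `|(v *m x) 0 0| <= N v * euclid_norm (spectral_coord A f b j x).
  by move=> {1}<-; rewrite -mulmxA PiE; exact: row_mul_le_euclid_norm.
exists u1, u2, (complex.Im l), i0, (N u1 + N u2 + 1); split => //.
  by have := N0 u1; have := N0 u2; lra.
move=> x; split.
  apply: le_trans (vP _ x P1) _; apply: ler_wpM2r; first exact: euclid_norm_ge0.
  by have := N0 u2; lra.
apply: le_trans (vP _ x P2) _; apply: ler_wpM2r; first exact: euclid_norm_ge0.
by have := N0 u1; lra.
Qed.

Lemma spectral_component_cvg0 (eps : R) j : 0 < eps -> 0 < a j ->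
  {ae P, forall w, (T - t) `^ (- Num.min (a j) (1 / 2) + eps) * Xnorm j w t
     @[t --> T^'-] --> (0 : R)}.
Proof.
move=> eps0 a0; set mn := Num.min (a j) (1 / 2).
have mn0 : 0 < mn by rewrite lt_min a0 divr_gt0.
have mnl : mn <= a j by rewrite ge_min lexx.
have mnr : mn <= 1 / 2 by rewrite ge_min lexx orbT.
(* Positive and below [mn], yet by less than eps, so that the weight leaves a decaying
   exponential. *)
pose kap := mn - Num.min eps mn / 2.
have e1 : 0 < Num.min eps mn by rewrite lt_min eps0.
have e2 : Num.min eps mn <= eps by rewrite ge_min lexx.
have e3 : Num.min eps mn <= mn by rewrite ge_min lexx orbT.
have k0 : 0 < kap by rewrite /kap; lra.
have ka : kap < a j by rewrite /kap; lra.
have k12 : kap < 1 / 2 by rewrite /kap; lra.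
have r0 : 0 < kap - mn + eps by rewrite /kap; lra.
apply: filterS (spectral_component_upper k0 ka k12) => w [K [s0 sP]].
apply/cvgrPdist_le => e e0; apply/(near_clockP _ T0).
have [s1 s1P] := expR_small (T `^ (- mn + eps) * K) e0.
exists (Num.max s0 (s1 / (kap - mn + eps))) => s; rewrite ge_max => /andP[h0 h1].
rewrite sub0r normrN ger0_norm ?mulr_ge0 ?powR_ge0// powR_clock//.
apply: le_trans (s1P (s * (kap - mn + eps)) _); last by rewrite -ler_pdivrMr.
have -> : T `^ (- mn + eps) * K * expR (- (s * (kap - mn + eps))) =
   T `^ (- mn + eps) * expR (- ((- mn + eps) * s)) * (K * expR (- kap * s)).
  have -> : - (s * (kap - mn + eps)) = - ((- mn + eps) * s) + - kap * s by ring.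
  by rewrite expRD; ring.
by apply: ler_wpM2l; [rewrite mulr_ge0 ?powR_ge0 ?expR_ge0|exact: sP].
Qed.

Lemma spectral_component_cvgy (eps : R) j : \rank Sigma = d.+1 -> 0 < eps ->
  0 < a j -> a j < 1 / 2 ->
  {ae P, forall w, (T - t) `^ (- a j - eps) * Xnorm j w t @[t --> T^'-] --> +oo}.
Proof.
move=> rS eps0 a0 a12.
have [u1 [u2 [be [i0 [M [u1A u2A v0 M0 uM]]]]]] := spectral_component_eigenrow j rS.
apply: filterS (eigenrow_growth T0 hB hX u1A u2A v0 (ltW a0) a12) => w [c [s0 [c0 sP]]].
apply/cvgryPge => K; apply/(near_clockP _ T0).
(* The 2 M comes from |u1 X| + |u2 X| <= 2 M times the norm of the component; the weighted norm is
   then at least q e^(eps s). *)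
pose q := T `^ (- a j - eps) * (c / (2 * M)).
have q0 : 0 < q by rewrite mulr_gt0 ?powR_gt0// divr_gt0// mulr_gt0.
exists (Num.max (Num.max 0 s0) (`|K| / q / eps)) => s.
rewrite !ge_max => /andP[/andP[s_0 h0] h1].
have low : c / (2 * M) * expR (- (a j * s)) <= Xnorm j w (clock T s).
  have := sP s h0; rewrite /row_path !time_changedE// => cs.
  have [h2 h3] := uM (X (clock T s) w).
  rewrite -/(Xnorm _ _ _) in h2 h3.
  rewrite expRN ler_pdivrMr ?expR_gt0// ler_pdivrMr ?mulr_gt0//.
  apply: le_trans cs _; rewrite mulrC [leRHS]mulrAC.
  by apply: ler_wpM2r; [exact: expR_ge0|lra].
rewrite powR_clock//; apply: (@le_trans _ _ (q * expR (eps * s))).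
  apply: le_trans (ler_norm K) _.
  rewrite ler_pdivrMr// ler_pdivrMr// in h1; apply: le_trans h1 _.
  rewrite mulrC [s * eps]mulrC ler_pM2l//.
  by apply: le_trans (expR_ge1Dx _); rewrite lerDr.
have -> : q * expR (eps * s) = T `^ (- a j - eps) * expR (- ((- a j - eps) * s)) *
   (c / (2 * M) * expR (- (a j * s))).
  have -> : eps * s = - ((- a j - eps) * s) + - (a j * s) by ring.
  by rewrite expRD /q; ring.
by apply: ler_wpM2l => //; rewrite mulr_ge0 ?powR_ge0 ?expR_ge0.
Qed.

(** For a_j < 1/2 the full limit is infinite. Otherwise a weighted norm bounded near T would force
    u1 X and u2 X to be O(e^(- (1/2 + eps) s)), which [eigenrow_no_fast_decay] excludes. *)
Lemma spectral_component_limsup (eps : R) j : \rank Sigma = d.+1 -> 0 < eps -> 0 < a j ->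
  {ae P, forall w, limf_esup (fun t : R =>
     ((T - t) `^ (- Num.min (a j) (1 / 2) - eps) * Xnorm j w t)%:E) (T^'-) = +oo%E}.
Proof.
move=> rS eps0 a0; have [a12|a12] := ltP (a j) (1 / 2).
  apply: filterS (spectral_component_cvgy rS eps0 a0 a12) => w /cvgryPgt cy.
  apply: limf_esup_pinfty => V TV M.
  near (T^'-) => t; exists t; near: t; [exact: TV|exact: cy].
have [u1 [u2 [be [i0 [M [u1A u2A v0 M0 uM]]]]]] := spectral_component_eigenrow j rS.
apply: filterS (eigenrow_no_fast_decay T0 hB hX u1A v0 eps0) => w slow.
apply: limf_esup_pinfty => V /(near_clockP _ T0)[s0 sV] K.
apply: contrapT => noV; apply: slow.
pose q := T `^ (- (1 / 2) - eps).
have q0 : 0 < q by rewrite powR_gt0.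
exists (M * (K / q)), (Num.max 0 s0) => s; rewrite ge_max => /andP[s_0 hs].
have up : Xnorm j w (clock T s) <= K / q * expR (- (1 / 2 + eps) * s).
  rewrite leNgt; apply/negP => bad; apply: noV; exists (clock T s); first exact: sV.
  rewrite powR_clock// -/q.
  have E0 := expR_gt0 (- ((- (1 / 2) - eps) * s)).
  have -> : K = q * expR (- ((- (1 / 2) - eps) * s)) * (K / q * expR (- (1 / 2 + eps) * s)).
    have -> : - (1 / 2 + eps) * s = (- (1 / 2) - eps) * s by ring.
    by rewrite expRN; field; rewrite ?(gt_eqF q0) ?(gt_eqF (expR_gt0 _)).
  by rewrite ltr_pM2l// mulr_gt0.
have [h1 h2] := uM (X (clock T s) w).
have up' : M * euclid_norm (spectral_coord A f b j (X (clock T s) w)) <=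
    M * (K / q) * expR (- (1 / 2 + eps) * s).
  by rewrite -mulrA; apply: ler_wpM2l up; exact: ltW.
by rewrite /row_path !time_changedE//; split; [exact: le_trans h1 up'|exact: le_trans h2 up'].
Unshelve. all: by end_near. Qed.

End SpectralComponents.

Theorem theorem4p2 (R : realType) (dsp : measure_display)
    (Omega : measurableType dsp) (P : probability Omega R)
    (T : R) (hT : 0 < T) (d m : nat)
    (A : 'M[R]_d.+1) (Sigma : 'M[R]_(d.+1, m))
    (B : R -> Omega -> 'cV[R]_m) (hB : standard_wiener P T B)
    (X : R -> Omega -> 'cV[R]_d.+1) (hX : strong_solution P T A Sigma B X)
    (p : nat) (a : 'I_p -> R)
    (ha_incr : forall i j : 'I_p, (i < j)%N -> a i < a j)
    (ha_spec : range a = ReSpec A)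
    (f : 'I_p -> {poly R}) (hf : spectral_factorization A a f)
    (dim : 'I_p -> nat) (b : forall j : 'I_p, 'M[R]_(d.+1, dim j))
    (hb : forall j : 'I_p, column_basis (polyker A (f j)) (b j))
    (hA : ReSpec A `<=` `]0, +oo[) (hSigma : \rank Sigma = d.+1) :
  let Xnorm (j : 'I_p) (w : Omega) (t : R) : R :=
    euclid_norm (spectral_coord A f b j (X t w)) in
  (forall (eps : R) (j : 'I_p), 0 < eps ->
     {ae P, forall w,
        (T - t) `^ (- Num.min (a j) (1 / 2) + eps) * Xnorm j w t
          @[t --> T^'-] --> (0 : R)} /\
     {ae P, forall w,
        limf_esup (fun t : R =>
          ((T - t) `^ (- Num.min (a j) (1 / 2) - eps) * Xnorm j w t)%:E)
          (T^'-) = +oo%E}) /\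
  (ReSpec A `<=` `]0, 1 / 2[ ->
   forall (eps : R) (j : 'I_p), 0 < eps ->
     {ae P, forall w,
        (T - t) `^ (- a j - eps) * Xnorm j w t @[t --> T^'-] --> +oo}).
Proof.
move=> Xnorm.
have aS j : ReSpec A (a j) by rewrite -ha_spec; exists j.
have a0 j : 0 < a j by have := hA _ (aS j); rewrite /= in_itv /= andbT.
split=> [eps j eps0|hA12 eps j eps0].
  split; first exact: (spectral_component_cvg0 hT hB hX ha_incr hf hb eps0 (a0 j)).
  exact: (spectral_component_limsup hT hB hX ha_incr ha_spec hf hb hSigma eps0 (a0 j)).
apply: (spectral_component_cvgy hT hB hX ha_incr ha_spec hf hb hSigma eps0 (a0 j)).
by have := hA12 _ (aS j); rewrite /= in_itv /= => /andP[].
Qed.
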